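(* Let $B$ be an arbitrary set of positive integers. Then there exists an increasing sequence $(s_n)_{n\ge 1}$ of positive integers such that: (i) for every $g\in \mathbb{N}\setminus B$, the sequence $(s_n^g)_{n\ge1}$ is good for the mean ergodic theorem; (ii) for every $b\in B$, the sequence $(s_n^b)_{n\ge1}$ is not good for the mean ergodic theorem.
   Context: $\mathbb{N}=\{1,2,3,\dots\}$. A (measure preserving) system is a quadruple $(X,\mathcal{B},\mu,T)$ where $T$ is an invertible measure preserving transformation of a probability space $(X,\mathcal{B},\mu)$. A sequence $(a_n)_{n\ge1}$ of integers is good for the mean ergodic theorem if for every system $(X,\mathcal{B},\mu,T)$ and every $f\in L^2(\mu)$ the averages $\frac1N\sum_{n=1}^N f(T^{a_n}x)$ converge in the $L^2(\mu)$ norm as $N\to\infty$. *)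

(* Defs.v *)
From HB Require Import structures.
From mathcomp Require Import all_boot all_order all_algebra.
From mathcomp Require Import complex.
From mathcomp Require Import all_classical all_reals all_analysis.

Set Implicit Arguments.
Unset Strict Implicit.
Unset Printing Implicit Defensive.

Import Order.TTheory GRing.Theory Num.Theory.
Import numFieldNormedType.Exports.

Local Open Scope classical_set_scope.
Local Open Scope ring_scope.

Section MeasurePreserving.
Context (R : realType) (d : measure_display) (X : measurableType d).

(* [Tinv] is the inverse of [T], so [measurable_fun setT Tinv] is part of
   the invertibility of [T] as a map of measurable spaces. *)
Definition invertible_measure_preserving (mu : probability X R)
    (T Tinv : X -> X) : Prop :=
  [/\ cancel T Tinv, cancel Tinv T,
      measurable_fun setT T, measurable_fun setT Tinv &
      forall A : set X, measurable A -> mu (T @^-1` A) = mu A].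

(* The power [T ^ k] for an arbitrary integer [k]; [Negz n] is [- (n + 1)]. *)
Definition iterz (T Tinv : X -> X) (k : int) : X -> X :=
  match k with
  | Posz n => iter n T
  | Negz n => iter n.+1 Tinv
  end.

(* [L^2(mu)] consists of complex-valued functions. *)
Definition L2C (mu : probability X R) (f : X -> R[i]) : Prop :=
  (fun x => complex.Re (f x)) \in Lfun mu 2%:E /\
  (fun x => complex.Im (f x)) \in Lfun mu 2%:E.

Definition L2C_norm (mu : probability X R) (f : X -> R[i]) : \bar R :=
  Lnorm mu 2%:E (fun x => (ComplexField.Normc.normc (f x))%:E).

(* At [N = 0] this is [0], which is irrelevant to the limit. *)
Definition ergodic_average (T Tinv : X -> X) (a : nat -> int)
    (f : X -> R[i]) (N : nat) : X -> R[i] :=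
  fun x => N%:R^-1 * \sum_(1 <= n < N.+1) f (iterz T Tinv (a n) x).

End MeasurePreserving.

(* Sequences are indexed by [n >= 1]: the value [a 0] is never used. *)
Definition good_for_mean_ergodic (R : realType) (a : nat -> int) : Prop :=
  forall (d : measure_display) (X : measurableType d) (mu : probability X R)
         (T Tinv : X -> X),
    invertible_measure_preserving mu T Tinv ->
    forall f : X -> R[i], L2C mu f ->
    exists2 g : X -> R[i], L2C mu g &
      L2C_norm mu (ergodic_average T Tinv a f N \- g) @[N --> \oo] --> 0%E.

(* Main.v *)
Require Import Defs.
From HB Require Import structures.
From mathcomp Require Import all_boot all_order all_algebra.
From mathcomp Require Import complex.
From mathcomp Require Import all_classical all_reals all_analysis.
From mathcomp Require Import measurable_realfun.
From mathcomp Require Import ring lra zify.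

Set Implicit Arguments.
Unset Strict Implicit.
Unset Printing Implicit Defensive.

Import Order.TTheory GRing.Theory Num.Theory.
Import numFieldNormedType.Exports.

Local Open Scope classical_set_scope.
Local Open Scope ring_scope.

(** The term [s (n + 1)] is [2 * n + 2] or [2 * n + 3]. Sort the indices [n] by
    their level, the exponent of [2] in [n + 1], and let only the level [b] spoil
    the exponent [b] of [B]: there the choice between the two values follows
    the sign of [cos (angle * (2 * n + 2) ^ b)], where [angle] is not commensurable
    with [pi], and the choice is reversed on every other dyadic block of
    indices. On the levels that are not in [B] the choice is constant.

    Badness. For a rotation of the circle by [angle], and by [angle + pi] in
    order to separate the even terms from the odd ones, the averages along the
    powers [s n ^ b] contain the averages of [|cos (angle * (2 * n + 2) ^ b)|]
    over the level [b], with a sign alternating from block to block. These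
    diverge ([alt_not_hasmean], [bad_seq_not_hasmean]). All other contributions
    converge, for the same reason as below.

    Goodness. For [g] outside [B] the averages of [U ^ (s n ^ g) f], where [U]
    is the Koopman operator, reduce to averages over one level of
    [U ^ ((2 * n + j) ^ g) f], alone or multiplied by the sign of
    [cos (angle * (2 * n + 2) ^ c)] with [c] different from [g]. The first kind
    converges ([hasmean_integer_poly]). In the second kind the sign is
    approximated by odd polynomials in the cosine ([mean0_sgn]), which leaves
    averages of [cos (k * angle * (2 * n + 2) ^ c) * U ^ ((2 * n + j) ^ g) f] with
    nonzero [k]; these tend to zero because the two exponents differ
    ([mean0_twisted]), and the alternation of the blocks does not change that
    ([mean0_alt]).

    Both statements on polynomial averages hold for isometric actions on any
    complete inner product space and rest on two facts. By van der Corput's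
    inequality the averages along a polynomial sequence vanish once all powers
    of its top coefficient average to zero ([mean0_polynomial]). By the mean
    ergodic theorem every vector is a sum of a limit of periodic vectors and of
    a vector for which that hypothesis holds ([rational_decomposition]); and on
    periodic vectors the action only depends on the residue of [n]. *)

(** * Spaces with a semi-inner product *)

(** Real scalars suffice since ergodic averages have real coefficients, so that
    real and imaginary parts can be averaged separately. The form may be
    degenerate: square integrable functions are not identified when they agree
    almost everywhere, which keeps the Koopman operator an exact action. *)
Record preHilbert (R : realType) := PreHilbert {
  carrier :> lmodType R;
  dot : carrier -> carrier -> R;
  dotC : forall x y, dot x y = dot y x;
  dotDl : forall x y z, dot (x + y) z = dot x z + dot y z;
  dotZl : forall a x y, dot (a *: x) y = a * dot x y;
  dot_ge0 : forall x, 0 <= dot x x }.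

Section SeminormTheory.
Context (R : realType) (V : preHilbert R).
Implicit Types (x y z : V) (a : R).

Definition nrm x : R := Num.sqrt (dot x x).

Lemma dotDr x y z : dot x (y + z) = dot x y + dot x z.
Proof. by rewrite dotC dotDl dotC (dotC z). Qed.

Lemma dotZr a x y : dot x (a *: y) = a * dot x y.
Proof. by rewrite dotC dotZl dotC. Qed.

Lemma dot0l y : dot (0 : V) y = 0.
Proof. by rewrite -(scale0r (0 : V)) dotZl mul0r. Qed.

Lemma dotNl x y : dot (- x) y = - dot x y.
Proof. by rewrite -scaleN1r dotZl mulN1r. Qed.

Lemma dotNr x y : dot x (- y) = - dot x y.
Proof. by rewrite dotC dotNl dotC. Qed.

Lemma dotBl x y z : dot (x - y) z = dot x z - dot y z.
Proof. by rewrite dotDl dotNl. Qed.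

Lemma dotBr x y z : dot x (y - z) = dot x y - dot x z.
Proof. by rewrite dotDr dotNr. Qed.

Lemma dot_suml (I : Type) (r : seq I) (P : pred I) (F : I -> V) y :
  dot (\sum_(i <- r | P i) F i) y = \sum_(i <- r | P i) dot (F i) y.
Proof.
by apply: (big_morph (fun x : V => dot x y)) => [u v|]; rewrite ?dotDl ?dot0l.
Qed.

Lemma dot_sumr (I : Type) (r : seq I) (P : pred I) (F : I -> V) y :
  dot y (\sum_(i <- r | P i) F i) = \sum_(i <- r | P i) dot y (F i).
Proof. by rewrite dotC dot_suml; apply: eq_bigr => i _; rewrite dotC. Qed.

Lemma nrm_ge0 x : 0 <= nrm x.
Proof. exact: sqrtr_ge0. Qed.

Lemma nrm_sqr x : nrm x ^+ 2 = dot x x.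
Proof. by rewrite sqr_sqrtr// dot_ge0. Qed.

Lemma nrm0 : nrm 0 = 0.
Proof. by rewrite /nrm dot0l sqrtr0. Qed.

Lemma nrmN x : nrm (- x) = nrm x.
Proof. by rewrite /nrm dotNl dotNr opprK. Qed.

Lemma nrmBC x y : nrm (x - y) = nrm (y - x).
Proof. by rewrite -nrmN opprB. Qed.

Lemma nrmZ a x : nrm (a *: x) = `|a| * nrm x.
Proof.
rewrite /nrm dotZl dotZr mulrA -expr2 sqrtrM ?sqr_ge0//.
by rewrite sqrtr_sqr.
Qed.

(** The usual discriminant argument, applied to [t *: x - s *: y] instead of
    [x - s *: y] because [dot y y] may vanish for a nonzero [y]. *)
Lemma dot_sqr_le x y : dot x y ^+ 2 <= dot x x * dot y y.
Proof.
have H (s t : R) : 0 <= t ^+ 2 * dot x x - (2 * s * t) * dot x y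
                        + s ^+ 2 * dot y y.
  have := dot_ge0 (t *: x - s *: y).
  rewrite dotBl !dotBr !dotZl !dotZr (dotC y x); lra.
have xx := dot_ge0 x; have yy := dot_ge0 y.
have [y0|y0] := eqVneq (dot y y) 0.
  rewrite y0 mulr0; have [->|d0] := eqVneq (dot x y) 0.
    by rewrite expr0n.
  have := H ((dot x x + 1) / (2 * dot x y)) 1.
  rewrite y0 mulr0 addr0 expr1n mul1r mulr1.
  suff -> : 2 * ((dot x x + 1) / (2 * dot x y)) * dot x y = dot x x + 1 by lra.
  by field; lra.
have yp : 0 < dot y y by rewrite lt_def y0.
have := H (dot x y) (dot y y).
have -> : dot y y ^+ 2 * dot x x - 2 * dot x y * dot y y * dot x y
          + dot x y ^+ 2 * dot y y
        = dot y y * (dot x x * dot y y - dot x y ^+ 2) by ring.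
by rewrite pmulr_rge0// subr_ge0.
Qed.

Lemma abs_dot_le x y : `|dot x y| <= nrm x * nrm y.
Proof.
rewrite -ler_sqr ?nnegrE ?mulr_ge0 ?nrm_ge0//.
by rewrite real_normK ?num_real// exprMn !nrm_sqr dot_sqr_le.
Qed.

Lemma dot_le x y : dot x y <= nrm x * nrm y.
Proof. exact: le_trans (ler_norm _) (abs_dot_le x y). Qed.

Lemma nrmD x y : nrm (x + y) <= nrm x + nrm y.
Proof.
rewrite -ler_sqr ?nnegrE ?addr_ge0 ?nrm_ge0//.
rewrite nrm_sqr dotDl !dotDr (dotC y x) sqrrD !nrm_sqr.
have := dot_le x y; lra.
Qed.

Lemma nrmB x y : nrm (x - y) <= nrm x + nrm y.
Proof. by rewrite -(nrmN y) nrmD. Qed.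

Lemma nrm_triangle y x z : nrm (x - z) <= nrm (x - y) + nrm (y - z).
Proof. by have := nrmD (x - y) (y - z); rewrite addrA subrK. Qed.

Lemma nrm_sum (I : Type) (r : seq I) (P : pred I) (F : I -> V) :
  nrm (\sum_(i <- r | P i) F i) <= \sum_(i <- r | P i) nrm (F i).
Proof.
elim/big_ind2 : _ => [|x a y b xa yb|//]; first by rewrite nrm0.
exact: le_trans (nrmD _ _) (lerD xa yb).
Qed.

Lemma parallelogram x y :
  dot (x - y) (x - y) = 2 * dot x x + 2 * dot y y - dot (x + y) (x + y).
Proof. rewrite dotBl !dotBr dotDl !dotDr; ring. Qed.

(** Jensen's inequality for the square of the seminorm. *)
Lemma nrm_sum_sqr (x : nat -> V) N :
  nrm (\sum_(n < N) x n) ^+ 2 <= N%:R * \sum_(n < N) nrm (x n) ^+ 2.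
Proof.
elim: N => [|N IH]; first by rewrite !big_ord0 nrm0 expr0n mul0r.
rewrite !big_ord_recr/= nrm_sqr dotDl !dotDr (dotC (x N)) -!nrm_sqr.
set S := \sum_(n < N) x n in IH *.
set Q := \sum_(n < N) _ in IH *.
have h : dot S (x N) *+ 2 <= Q + N%:R * nrm (x N) ^+ 2.
  have -> : N%:R * nrm (x N) ^+ 2 = \sum_(i < N) nrm (x N) ^+ 2.
    by rewrite sumr_const card_ord mulr_natl.
  rewrite dot_suml /Q -sumrMnl -big_split/=; apply: ler_sum => i _.
  have := dot_ge0 (x i - x N).
  by rewrite dotBl !dotBr (dotC (x N)) -!nrm_sqr; lra.
rewrite -(natr1 N); nra.
Qed.

End SeminormTheory.

Section RealLine.
Context (R : realType).

Let dot1 (x y : R^o) : R := x * y.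

Definition realH : preHilbert R.
Proof.
apply: (@PreHilbert R R^o dot1) => [x y|x y z|a x y|x].
- exact: mulrC.
- exact: mulrDl.
- exact: (esym (mulrA a x y)).
- by rewrite /dot1 -expr2 sqr_ge0.
Defined.

Lemma nrm_realH (x : realH) : nrm x = `|x : R|.
Proof. exact: (@sqrtr_sqr R x). Qed.

End RealLine.

Section Product.
Context (R : realType) (V W : preHilbert R).

Definition prodH : preHilbert R.
Proof.
apply: (@PreHilbert R (V * W)%type (fun p q => dot p.1 q.1 + dot p.2 q.2)).
- by move=> x y; rewrite dotC (dotC x.2).
- by move=> x y z /=; rewrite !dotDl addrACA.
- by move=> a x y /=; rewrite !dotZl mulrDr.
- by move=> x; rewrite addr_ge0 ?dot_ge0.
Defined.

Lemma nrm_prodH_sqr (p : prodH) : nrm p ^+ 2 = nrm p.1 ^+ 2 + nrm p.2 ^+ 2.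
Proof. by rewrite !nrm_sqr. Qed.

Lemma nrm_fst_le (p : prodH) : nrm p.1 <= nrm p.
Proof.
rewrite -ler_sqr ?nnegrE ?nrm_ge0// nrm_prodH_sqr lerDl; exact: sqr_ge0.
Qed.

Lemma nrm_prodH_le (p : prodH) : nrm p <= nrm p.1 + nrm p.2.
Proof.
rewrite -ler_sqr ?nnegrE ?addr_ge0 ?nrm_ge0// nrm_prodH_sqr.
have := nrm_ge0 p.1; have := nrm_ge0 p.2; nra.
Qed.

End Product.

(** * Means of sequences and van der Corput's inequality *)

Section Means.
Context (R : realType).
Implicit Types V W : preHilbert R.

(** The averages of [x] are eventually within [e] of [y], without the division.
    With [y] depending on [e], as in [hasmean], this is the Cauchy property; so
    one calculus with [mean_within] serves for sequences with a known limit and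
    for those where only convergence is claimed. *)
Definition mean_within V (x : nat -> V) (y : V) (e : R) : Prop :=
  \forall N \near \oo, nrm (\sum_(n < N) x n - N%:R *: y) <= e * N%:R.

Definition mean_to V (x : nat -> V) (y : V) : Prop :=
  forall e, 0 < e -> mean_within x y e.

Definition hasmean V (x : nat -> V) : Prop :=
  forall e, 0 < e -> exists y, mean_within x y e.

Lemma near_le_natM (C e : R) : 0 < e -> \forall N \near \oo, C <= e * N%:R.
Proof.
move=> e0; near=> N; rewrite mulrC -ler_pdivrMr//.
apply: le_trans (ler_norm _) _; near: N; exact: nbhs_infty_ger.
Unshelve. all: by end_near. Qed.

Section OneSpace.
Context V.
Implicit Types (x : nat -> V) (y : V) (e : R).

Lemma mean_within_le x y e e' : e <= e' ->
  mean_within x y e -> mean_within x y e'.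
Proof.
move=> ee h; near=> N; have h' : nrm (\sum_(n < N) x n - N%:R *: y) <= e * N%:R.
  by near: N.
by apply: le_trans h' _; rewrite ler_wpM2r.
Unshelve. all: by end_near. Qed.

Lemma mean_withinD x x' y y' e e' : mean_within x y e -> mean_within x' y' e' ->
  mean_within (fun n => x n + x' n) (y + y') (e + e').
Proof.
move=> h h'; near=> N.
rewrite big_split/= scalerDr opprD addrACA mulrDl.
by apply: le_trans (nrmD _ _) _; apply: lerD; near: N.
Unshelve. all: by end_near. Qed.

Lemma mean_withinZ a x y e : mean_within x y e ->
  mean_within (fun n => a *: x n) (a *: y) (`|a| * e).
Proof.
move=> h; near=> N.
rewrite -scaler_sumr scalerA mulrC -scalerA -scalerBr nrmZ -mulrA.
by apply: ler_wpM2l => //; near: N.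
Unshelve. all: by end_near. Qed.

Lemma mean_within_approx x x' y e e' : mean_within x y e ->
  (\forall N \near \oo, \sum_(n < N) nrm (x' n - x n) <= e' * N%:R) ->
  mean_within x' y (e' + e).
Proof.
move=> h h'; near=> N.
apply: le_trans (nrm_triangle (\sum_(n < N) x n) _ _) _.
rewrite mulrDl; apply: lerD; last by near: N.
rewrite -sumrB; apply: le_trans (nrm_sum _ _ _) _; near: N; exact: h'.
Unshelve. all: by end_near. Qed.

Lemma mean_to_hasmean x y : mean_to x y -> hasmean x.
Proof. by move=> h e e0; exists y; apply: h. Qed.

Lemma mean_to_approx x y :
  (forall e, 0 < e -> exists2 x', mean_to x' y &
     \forall N \near \oo, \sum_(n < N) nrm (x n - x' n) <= e * N%:R) ->
  mean_to x y.
Proof.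
move=> H e e0; have [|x' hx' hN] := H (e / 2); first by rewrite divr_gt0.
have -> : e = e / 2 + e / 2 by lra.
by apply: (mean_within_approx _ hN); apply: hx'; rewrite divr_gt0.
Qed.

Lemma hasmean_approx x :
  (forall e, 0 < e -> exists2 x', hasmean x' &
     \forall N \near \oo, \sum_(n < N) nrm (x n - x' n) <= e * N%:R) ->
  hasmean x.
Proof.
move=> H e e0; have [|x' hx' hN] := H (e / 2); first by rewrite divr_gt0.
have [|y hy] := hx' (e / 2); first by rewrite divr_gt0.
exists y; have -> : e = e / 2 + e / 2 by lra.
exact: (mean_within_approx hy hN).
Qed.

Lemma mean_toD x x' y y' : mean_to x y -> mean_to x' y' ->
  mean_to (fun n => x n + x' n) (y + y').
Proof.
move=> h h' e e0; have -> : e = e / 2 + e / 2 by lra.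
by apply: mean_withinD; [apply: h|apply: h']; rewrite divr_gt0.
Qed.

Lemma mean_toZ a x y : mean_to x y -> mean_to (fun n => a *: x n) (a *: y).
Proof.
move=> h e e0.
have a1 : 0 < `|a| + 1 by rewrite ltr_wpDl.
have := mean_withinZ a (h (e / (`|a| + 1)) (divr_gt0 e0 a1)).
apply: mean_within_le; rewrite mulrCA ger_pMr//.
by rewrite ler_pdivrMr// mul1r lerDl.
Qed.

Lemma mean_to_ext x x' y : x =1 x' -> mean_to x y -> mean_to x' y.
Proof. by move=> /funext ->. Qed.

Lemma mean_toN x y : mean_to x y -> mean_to (fun n => - x n) (- y).
Proof.
move=> /(mean_toZ (-1)); rewrite scaleN1r.
by apply: mean_to_ext => n; rewrite scaleN1r.
Qed.

Lemma hasmeanD x x' : hasmean x -> hasmean x' ->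
  hasmean (fun n => x n + x' n).
Proof.
move=> h h' e e0; have -> : e = e / 2 + e / 2 by lra.
have [|y hy] := h (e / 2); first by rewrite divr_gt0.
have [|y' hy'] := h' (e / 2); first by rewrite divr_gt0.
by exists (y + y'); apply: mean_withinD.
Qed.

Lemma hasmeanZ a x : hasmean x -> hasmean (fun n => a *: x n).
Proof.
move=> h e e0.
have a1 : 0 < `|a| + 1 by rewrite ltr_wpDl.
have [y hy] := h (e / (`|a| + 1)) (divr_gt0 e0 a1).
exists (a *: y); have := mean_withinZ a hy.
apply: mean_within_le; rewrite mulrCA ger_pMr//.
by rewrite ler_pdivrMr// mul1r lerDl.
Qed.

Lemma hasmean_ext x x' : x =1 x' -> hasmean x -> hasmean x'.
Proof. by move=> /funext ->. Qed.

Lemma hasmeanB x x' : hasmean x -> hasmean x' ->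
  hasmean (fun n => x n - x' n).
Proof.
move=> h /(hasmeanZ (-1)) h'; apply: hasmean_ext (hasmeanD h h') => n.
by rewrite scaleN1r.
Qed.

Lemma mean_to_cst y : mean_to (fun=> y) y.
Proof.
move=> e e0; near=> N.
by rewrite sumr_const card_ord scaler_nat subrr nrm0 mulr_ge0// ltW.
Unshelve. all: by end_near. Qed.

Lemma mean_to_sum (I : Type) (r : seq I) (P : pred I) (F : I -> nat -> V) :
  (forall i, P i -> mean_to (F i) 0) ->
  mean_to (fun n => \sum_(i <- r | P i) F i n) 0.
Proof.
move=> H; elim: r => [|i r IH].
  by apply: mean_to_ext (mean_to_cst 0) => n; rewrite big_nil.
have [Pi|nPi] := boolP (P i); last first.
  by apply: mean_to_ext IH => n; rewrite big_cons (negbTE nPi).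
have := mean_toD (H i Pi) IH; rewrite addr0; apply: mean_to_ext => n.
by rewrite big_cons Pi.
Qed.

Lemma hasmean_sum (I : Type) (r : seq I) (P : pred I) (F : I -> nat -> V) :
  (forall i, P i -> hasmean (F i)) ->
  hasmean (fun n => \sum_(i <- r | P i) F i n).
Proof.
move=> H; elim: r => [|i r IH].
  apply: hasmean_ext (mean_to_hasmean (mean_to_cst 0)) => n.
  by rewrite big_nil.
have [Pi|nPi] := boolP (P i); last first.
  by apply: hasmean_ext IH => n; rewrite big_cons (negbTE nPi).
by apply: hasmean_ext (hasmeanD (H i Pi) IH) => n; rewrite big_cons Pi.
Qed.

Lemma sum_le_natM (r : nat -> R) (e : R) : (forall n, r n <= e) ->
  forall N, \sum_(n < N) r n <= e * N%:R.
Proof.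
move=> re N; apply: (@le_trans _ _ (\sum_(n < N) e)); first exact: ler_sum.
by rewrite sumr_const card_ord mulr_natr.
Qed.

Lemma mean_to_approx_unif x y :
  (forall e, 0 < e -> exists2 x', mean_to x' y &
     forall n, nrm (x n - x' n) <= e) ->
  mean_to x y.
Proof.
move=> H; apply: mean_to_approx => e /H[x' hx' le]; exists x' => //.
apply: nearW; exact: (@sum_le_natM (fun n => nrm (x n - x' n))).
Qed.

Lemma hasmean_approx_unif x :
  (forall e, 0 < e -> exists2 x', hasmean x' &
     forall n, nrm (x n - x' n) <= e) ->
  hasmean x.
Proof.
move=> H; apply: hasmean_approx => e /H[x' hx' le]; exists x' => //.
apply: nearW; exact: (@sum_le_natM (fun n => nrm (x n - x' n))).
Qed.

Lemma mean0_bounded_sums x C :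
  (forall N, nrm (\sum_(n < N) x n) <= C) -> mean_to x 0.
Proof.
move=> h e e0; near=> N; rewrite scaler0 subr0.
apply: le_trans (h N) _; near: N; exact: near_le_natM.
Unshelve. all: by end_near. Qed.

Lemma mean0P x : mean_to x 0 <->
  forall e, 0 < e -> \forall N \near \oo, nrm (\sum_(n < N) x n) <= e * N%:R.
Proof.
split=> h e e0; apply: filterS (h e e0) => N; by rewrite scaler0 subr0.
Qed.

Lemma mean0_shift x h : mean_to x 0 -> mean_to (fun n => x (n + h)%N) 0.
Proof.
move=> /mean0P hx; apply/mean0P => e e0.
have e4 : 0 < e / 4 by rewrite divr_gt0.
have e2 : 0 < e / 2 by rewrite divr_gt0.
have [n0 _ hn0] := hx _ e4.
near=> N.
have -> : \sum_(n < N) x (n + h)%N = \sum_(n < N + h) x n - \sum_(n < h) x n.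
  rewrite -!(big_mkord xpredT) (big_cat_nat (n := h))//= ?leq_addl//.
  by rewrite [RHS]addrC addKr -{2}(add0n h) big_addn addnK big_mkord.
apply: le_trans (nrmB _ _) _.
have h1 : nrm (\sum_(n < N + h) x n) <= e / 4 * (N + h)%:R.
  apply: hn0 => /=; apply: (@leq_trans N); last exact: leq_addr.
  near: N; exact: nbhs_infty_ge.
have h2 : e / 4 * h%:R + nrm (\sum_(n < h) x n) <= e / 2 * N%:R.
  near: N; exact: near_le_natM.
have := ler0n R N; rewrite natrD in h1; nra.
Unshelve. all: by end_near. Qed.

Lemma mean0_shift_diff (u : nat -> V) M h : (forall n, nrm (u n) <= M) ->
  mean_to (fun n => u (n + h)%N - u n) 0.
Proof.
move=> uM; elim: h => [|h IH].
  by apply: mean_to_ext (mean_to_cst 0) => n; rewrite addn0 subrr.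
have step : mean_to (fun n => u n.+1 - u n) 0.
  apply: (@mean0_bounded_sums _ (M + M)) => N.
  rewrite -(big_mkord xpredT (fun n => u n.+1 - u n)) telescope_sumr//.
  by apply: le_trans (nrmB _ _) _; apply: lerD.
have := mean_toD (mean0_shift h step) IH; rewrite addr0.
apply: mean_to_ext => n.
by rewrite addrA addnS subrK.
Qed.

End OneSpace.

Lemma mean_within_image V W (L : V -> W) (x : nat -> V) (y : V) e :
  linear L -> (forall v, nrm (L v) <= nrm v) ->
  mean_within x y e -> mean_within (fun n => L (x n)) (L y) e.
Proof.
move=> Llin Lle h.
have LB a b : L (a + b) = L a + L b by have := Llin 1 a b; rewrite !scale1r.
have L0 : L 0 = 0 by have := Llin (-1) 0 0; rewrite !scaleN1r !addNr.
have LZ a v : L (a *: v) = a *: L v by have := Llin a v 0; rewrite L0 !addr0.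
near=> N; have -> : \sum_(n < N) L (x n) - N%:R *: L y
    = L (\sum_(n < N) x n - N%:R *: y).
  rewrite LB -scaleN1r -(scaleN1r (_ *: y)) !LZ; congr (_ + _).
  by rewrite (big_morph L LB L0).
by apply: le_trans (Lle _) _; near: N.
Unshelve. all: by end_near. Qed.

Lemma mean_to_image V W (L : V -> W) (x : nat -> V) (y : V) :
  linear L -> (forall v, nrm (L v) <= nrm v) ->
  mean_to x y -> mean_to (fun n => L (x n)) (L y).
Proof. by move=> h1 h2 h e e0; apply: mean_within_image => //; apply: h. Qed.

Lemma mean_to_dot V (x : nat -> V) (y z : V) : mean_to x y ->
  mean_to (V := realH R) (fun n => dot (x n) z) (dot y z).
Proof.
move=> h e e0; have z1 : 0 < nrm z + 1 by rewrite ltr_wpDl ?nrm_ge0.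
have := h (e / (nrm z + 1)) (divr_gt0 e0 z1); rewrite /mean_within => h'.
near=> N; rewrite nrm_realH.
have -> : \sum_(n < N) (dot (x n) z : realH R) - N%:R *: (dot y z : realH R)
   = dot (\sum_(n < N) x n - N%:R *: y) z :> R.
  by rewrite dotBl dot_suml dotZl.
apply: le_trans (abs_dot_le _ _) _.
have h2 : nrm (\sum_(n < N) x n - N%:R *: y) <= e / (nrm z + 1) * N%:R.
  by near: N.
apply: le_trans (ler_wpM2r (nrm_ge0 _) h2) _.
rewrite mulrAC ler_wpM2r// mulrAC ler_pdivrMr// ler_pM2l// lerDl//.
Unshelve. all: by end_near. Qed.

Lemma mean_to_fst V W (x : nat -> prodH V W) y :
  mean_to x y -> mean_to (fun n => (x n).1) y.1.
Proof.
by apply: (@mean_to_image (prodH V W) V fst) => //; exact: nrm_fst_le.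
Qed.

Lemma mean_to_pair V W (x : nat -> V) (x' : nat -> W) y y' :
  mean_to x y -> mean_to x' y' ->
  mean_to (V := prodH V W) (fun n => (x n, x' n)) (y, y').
Proof.
move=> h h' e e0; have e2 : 0 < e / 2 by rewrite divr_gt0.
have := h _ e2; have := h' _ e2; rewrite /mean_within => hN' hN.
near=> N; apply: le_trans (nrm_prodH_le _) _.
have -> : \sum_(n < N) ((x n, x' n) : prodH V W)
    = (\sum_(n < N) x n, \sum_(n < N) x' n).
  by elim: (N) => [|k IH]; rewrite ?big_ord0// !big_ord_recr/= IH.
by rewrite [e in leRHS]splitr mulrDl lerD//=; near: N.
Unshelve. all: by end_near. Qed.

Lemma nrm_average V (s y : V) N : (0 < N)%N ->
  nrm (s - N%:R *: y) = nrm (N%:R^-1 *: s - y) * N%:R.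
Proof.
move=> N0; have N1 : N%:R != 0 :> R by rewrite pnatr_eq0 -lt0n.
have -> : s - N%:R *: y = N%:R *: (N%:R^-1 *: s - y).
  by rewrite scalerBr scalerA mulfV// scale1r.
by rewrite nrmZ ger0_norm// mulrC.
Qed.

(** Averaging the windows [u n + ... + u (n + H - 1)] does not change the mean
    of a bounded sequence, and if all nontrivial correlations vanish the
    windows have mean square about [H * M ^+ 2] instead of
    [H ^+ 2 * M ^+ 2]. *)
Lemma van_der_Corput V (u : nat -> V) M : (forall n, nrm (u n) <= M) ->
  (forall h, (0 < h)%N ->
     mean_to (V := realH R) (fun n => dot (u (n + h)%N) (u n)) 0) ->
  mean_to u 0.
Proof.
move=> uM corr; apply/mean0P => e e0.
have M0 : 0 <= M := le_trans (nrm_ge0 _) (uM 0%N).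
have [H Hpos HM] : exists2 H, (0 < H)%N & M ^+ 2 <= e ^+ 2 / 8 * H%:R.
  have e8 : 0 < e ^+ 2 / 8 by rewrite divr_gt0// exprn_gt0.
  have [n0 _ hn0] := near_le_natM (M ^+ 2) e8.
  by exists (maxn n0 1); [rewrite leq_max orbT|apply: hn0; rewrite /= leq_maxl].
have H0 : 0 < H%:R :> R by rewrite ltr0n.
pose v n := \sum_(h < H) u (n + h)%N.
have A : mean_to (V := realH R)
    (fun n => nrm (v n) ^+ 2 - \sum_(h < H) nrm (u (n + h)%N) ^+ 2 : R) 0.
  have : mean_to (V := realH R) (fun n => \sum_(h < H) \sum_(k < H | k != h)
      (dot (u (n + h)%N) (u (n + k)%N) : realH R)) 0.
    apply: mean_to_sum => h _; apply: mean_to_sum => k kh.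
    wlog hk : h k kh / (h < k)%N.
      move=> W; move: (kh); rewrite neq_ltn => /orP[kh'|]; last exact: W.
      have := W k h; rewrite eq_sym kh kh' => /(_ isT isT).
      by apply: mean_to_ext => n; rewrite dotC.
    have := corr (k - h)%N; rewrite subn_gt0 => /(_ hk) /(mean0_shift h).
    apply: mean_to_ext => n /=; rewrite dotC -addnA subnKC//; exact: ltnW.
  apply: mean_to_ext => n; rewrite nrm_sqr /v dot_suml.
  apply/esym/eqP; rewrite subr_eq; apply/eqP; rewrite -big_split/=.
  apply: eq_bigr => h _; rewrite dot_sumr (bigD1 h)//= addrC.
  by rewrite nrm_sqr.
have B : mean_to (fun n => v n - H%:R *: u n) 0.
  have : mean_to (fun n => \sum_(h < H) (u (n + h)%N - u n)) 0.
    by apply: mean_to_sum => h _; apply: mean0_shift_diff uM.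
  apply: mean_to_ext => n; rewrite sumrB sumr_const card_ord.
  by rewrite scaler_nat.
have c1 : 0 < e ^+ 2 / 8 * H%:R ^+ 2.
  by rewrite mulr_gt0// ?exprn_gt0// divr_gt0// exprn_gt0.
have c2 : 0 < e / 2 * H%:R by rewrite mulr_gt0// divr_gt0.
near=> N.
have N0 : 0 <= N%:R :> R by [].
have hB : nrm (\sum_(n < N) (v n - H%:R *: u n)) <= e / 2 * H%:R * N%:R.
  by near: N; move/mean0P : B; apply.
have hA : `|\sum_(n < N) (nrm (v n) ^+ 2 - \sum_(h < H) nrm (u (n + h)%N) ^+ 2)|
   <= e ^+ 2 / 8 * H%:R ^+ 2 * N%:R.
  by near: N; move/mean0P : A => /(_ _ c1); apply: filterS => N; rewrite nrm_realH.
have h1 : \sum_(n < N) nrm (v n) ^+ 2 <= (e / 2 * H%:R) ^+ 2 * N%:R.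
  have h2 : \sum_(n < N) \sum_(h < H) nrm (u (n + h)%N) ^+ 2
      <= e ^+ 2 / 8 * H%:R ^+ 2 * N%:R.
    apply: (@le_trans _ _ (\sum_(n < N) \sum_(h < H) M ^+ 2)).
      apply: ler_sum => n _; apply: ler_sum => h _.
      by rewrite ler_sqr ?nnegrE ?nrm_ge0.
    rewrite !sumr_const !card_ord -[leLHS]mulr_natr -[in leLHS](mulr_natr (M ^+ 2)).
    by rewrite ler_wpM2r// [H%:R ^+ 2]expr2 mulrA ler_wpM2r.
  move: hA; rewrite sumrB => /ler_normlP[_]; lra.
have h3 : nrm (\sum_(n < N) v n) <= e / 2 * H%:R * N%:R.
  rewrite -ler_sqr ?nnegrE ?nrm_ge0//; last by rewrite mulr_ge0// ltW.
  apply: le_trans (nrm_sum_sqr _ _) _.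
  apply: le_trans (ler_wpM2l N0 h1) _.
  lra.
have h4 : H%:R * nrm (\sum_(n < N) u n) <= e * H%:R * N%:R.
  have <- : nrm (H%:R *: \sum_(n < N) u n) = H%:R * nrm (\sum_(n < N) u n).
    by rewrite nrmZ ger0_norm.
  have -> : H%:R *: \sum_(n < N) u n
     = \sum_(n < N) v n - \sum_(n < N) (v n - H%:R *: u n).
    by rewrite sumrB opprB addrC subrK scaler_sumr.
  apply: le_trans (nrmB _ _) _; lra.
rewrite -(ler_pM2l H0); apply: le_trans h4 _.
by rewrite mulrA (mulrC e).
Unshelve. all: by end_near. Qed.

End Means.

(** * Isometric actions and polynomial sequences *)

Record isometric_action (R : realType) (G : zmodType) (V : preHilbert R) :=
  IsometricAction {
    act :> G -> V -> V;
    act_linear : forall g, linear (act g);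
    act_dot : forall g x y, dot (act g x) (act g y) = dot x y;
    act0 : forall x, act 0 x = x;
    actD : forall g h x, act (g + h) x = act g (act h x) }.

Section Polynomials.
Context (G : zmodType).

(** [w] is a polynomial of degree at most [d] and [c] its coefficient on the
    binomial ['C(n, d)]. Finite differences make sense in every abelian group and
    are what van der Corput's inequality produces. *)
Fixpoint is_poly (d : nat) (c : G) (w : nat -> G) : Prop :=
  if d is d'.+1 then
    forall h, is_poly d' (c *+ h) (fun n => w (n + h)%N - w n)
  else forall n, w n = c.

Lemma is_poly_ext d c w w' : w =1 w' -> is_poly d c w -> is_poly d c w'.
Proof. by move=> /funext ->. Qed.

Lemma is_poly_lower d c w : is_poly d c w -> is_poly d.+1 0 w.
Proof.
elim: d c w => [|d IH] c w H h.
  by move=> n; rewrite !H subrr mul0rn.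
rewrite mul0rn; exact: IH (H h).
Qed.

Lemma is_poly_weaken d d' c w : (d < d')%N -> is_poly d c w -> is_poly d' 0 w.
Proof.
elim: d' => // d' IH; rewrite ltnS leq_eqVlt => /predU1P[->|dd'] H.
  exact: is_poly_lower H.
exact: is_poly_lower (IH dd' H).
Qed.

Lemma is_polyD d c c' w w' : is_poly d c w -> is_poly d c' w' ->
  is_poly d (c + c') (fun n => w n + w' n).
Proof.
elim: d c c' w w' => [|d IH] c c' w w' /= H H'; first by move=> n; rewrite H H'.
move=> h; rewrite mulrnDl.
apply: is_poly_ext (IH _ _ _ _ (H h) (H' h)) => n.
by rewrite opprD addrACA.
Qed.

Lemma is_poly_dilate d c w q r : is_poly d c w ->
  is_poly d (c *+ q ^ d) (fun n => w (r + q * n)%N).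
Proof.
elim: d c w => [|d IH] c w /= H; first by move=> n; rewrite H expn0 mulr1n.
move=> h; have := IH _ _ (H (q * h)%N).
rewrite -!mulrnA expnS mulnAC.
by apply: is_poly_ext => n; rewrite mulnDr addnA.
Qed.

Lemma is_poly_const d c w a : is_poly d.+1 c w ->
  is_poly d.+1 c (fun n => w n + a).
Proof.
by move=> H h; apply: is_poly_ext (H h) => n; rewrite opprD addrACA subrr addr0.
Qed.

End Polynomials.

Lemma pair_mulrn (G H : zmodType) (a : G) (b : H) n :
  (a, b) *+ n = (a *+ n, b *+ n).
Proof. by elim: n => // n IH; rewrite !mulrS IH. Qed.

Lemma is_poly_pair (G G' : zmodType) d (c : G) (c' : G') w w' :
  is_poly d c w -> is_poly d c' w' ->
  is_poly d (c, c') (fun n => (w n, w' n)).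
Proof.
elim: d c c' w w' => [|d IH] c c' w w' /= H H'; first by move=> n; rewrite H H'.
by move=> h; rewrite pair_mulrn; exact: IH (H h) (H' h).
Qed.

Lemma is_poly_zero (G : zmodType) d : is_poly d (0 : G) (fun=> 0).
Proof.
elim: d => [//|d IH] h /=; rewrite mul0rn.
by apply: is_poly_ext IH => n; rewrite subrr.
Qed.

Lemma is_poly_scale (K : pzRingType) (k : K) d c w :
  is_poly d c w -> is_poly d (k * c) (fun n => k * w n).
Proof.
elim: d c w => [|d IH] c w /= H; first by move=> n; rewrite H.
move=> h; rewrite -mulrnAr; apply: is_poly_ext (IH _ _ (H h)) => n.
by rewrite mulrBr.
Qed.

Lemma is_poly_linear_factor (K : comPzRingType) (a b : K) d (c : K) w :
  is_poly d c w ->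
  is_poly d.+1 (a * c *+ d.+1) (fun n => (a *+ n + b) * w n).
Proof.
elim: d c w => [|d IH] c w H h.
  by move=> n; rewrite /= !H -mulrBl mulrnDr; ring.
have := is_polyD (IH _ _ (H h))
  (is_poly_scale (a *+ h) (is_poly_dilate 1 h H)).
rewrite exp1n mulr1n.
have -> : a * (c *+ h) *+ d.+1 + a *+ h * c = a * c *+ d.+2 *+ h.
  rewrite mulrnAr mulrnAl -!mulrnA -mulrnDr; congr (_ *+ _); lia.
apply: is_poly_ext => n; rewrite mul1n (addnC h) mulrnDr; ring.
Qed.

Lemma is_poly_linear_power (K : comPzRingType) (a b : K) d :
  is_poly d (a ^+ d *+ d`!) (fun n => (a *+ n + b) ^+ d).
Proof.
elim: d => [|d IH]; first by move=> n; rewrite !expr0 fact0 mulr1n.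
have := is_poly_linear_factor a b IH.
rewrite mulrnAr -exprS -mulrnA mulnC -factS.
by apply: is_poly_ext => n; rewrite exprS.
Qed.

(** * Polynomial averages and the mean ergodic theorem *)

Section Actions.
Context (R : realType) (G : zmodType) (V : preHilbert R).
Variable A : isometric_action G V.
Implicit Types (g : G) (x y f : V).

Lemma actV0 g : A g 0 = 0.
Proof. by have := act_linear A g (-1) 0 0; rewrite !scaleN1r !addNr. Qed.

Lemma actVD g x y : A g (x + y) = A g x + A g y.
Proof. by have := act_linear A g 1 x y; rewrite !scale1r. Qed.

Lemma actVZ g a x : A g (a *: x) = a *: A g x.
Proof. by have := act_linear A g a x 0; rewrite actV0 !addr0. Qed.

Lemma actVN g x : A g (- x) = - A g x.
Proof. by rewrite -scaleN1r actVZ scaleN1r. Qed.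

Lemma actVB g x y : A g (x - y) = A g x - A g y.
Proof. by rewrite actVD actVN. Qed.

Lemma nrm_act g x : nrm (A g x) = nrm x.
Proof. by rewrite /nrm act_dot. Qed.

Lemma mean_to_act g (x : nat -> V) y :
  mean_to x y -> mean_to (fun n => A g (x n)) (A g y).
Proof.
apply: mean_to_image; first exact: act_linear.
by move=> v; rewrite nrm_act.
Qed.

(** Weyl differencing. The correlations of [A (w n) f] are averages along the
    differences [w (n + h) - w n], whose top coefficient is a multiple of that
    of [w]; so the degree can be lowered down to [1], where the hypothesis
    itself is met. *)
Lemma mean0_polynomial d c w f : is_poly d.+1 c w ->
  (forall m, (0 < m)%N -> mean_to (fun n => A (c *+ m *+ n) f) 0) ->
  mean_to (fun n => A (w n) f) 0.
Proof.
elim: d c w => [|d IH] c w /= H top.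
  have wE n : w n = w 0%N + c *+ n by rewrite -(H n 0%N) addrC subrK.
  have := mean_to_act (w 0%N) (top 1%N isT); rewrite actV0.
  by apply: mean_to_ext => n; rewrite mulr1n -actD -wE.
apply: (@van_der_Corput _ _ _ (nrm f)) => [n|h h0]; first by rewrite nrm_act.
have : mean_to (fun n => A (w (n + h)%N - w n) f) 0.
  apply: IH (H h) _ => m m0.
  apply: mean_to_ext (top (h * m)%N _) => [n|]; first by rewrite mulrnA.
  by rewrite muln_gt0 h0.
move=> /(mean_to_dot f); rewrite dot0l; apply: mean_to_ext => n.
by rewrite -(act_dot A (w n)) -actD addrC subrK.
Qed.

Inductive orbit_hull g f : V -> Prop :=
| orbit_hull_base : orbit_hull g f f
| orbit_hull_act v : orbit_hull g f v -> orbit_hull g f (A g v)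
| orbit_hull_convex a v w : 0 <= a -> a <= 1 ->
    orbit_hull g f v -> orbit_hull g f w ->
    orbit_hull g f (a *: v + (1 - a) *: w).

Lemma orbit_hull_mean g f v : orbit_hull g f v ->
  mean_to (fun n => A (g *+ n) v - A (g *+ n) f) 0.
Proof.
elim=> [|{}v _ IH|a {}v w _ _ _ IHv _ IHw].
- by apply: mean_to_ext (mean_to_cst 0) => n; rewrite subrr.
- have uM n : nrm (A (g *+ n) v) <= nrm v by rewrite nrm_act.
  have := mean_toD (mean0_shift_diff 1 uM) IH; rewrite addr0.
  apply: mean_to_ext => n.
  by rewrite addn1 mulrSr actD addrA subrK.
- have := mean_toD (mean_toZ a IHv) (mean_toZ (1 - a) IHw).
  rewrite !scaler0 addr0; apply: mean_to_ext => n.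
  rewrite actVD !actVZ !scalerBr addrACA -opprD -[X in _ - X]scalerDl.
  by rewrite (_ : a + (1 - a) = 1) ?scale1r//; lra.
Qed.

Lemma orbit_hull_average g f v N : orbit_hull g f v ->
  orbit_hull g f (N.+1%:R^-1 *: \sum_(n < N.+1) A (g *+ n) v).
Proof.
move=> hv; have hn n : orbit_hull g f (A (g *+ n) v).
  elim: n => [|n IH]; first by rewrite mulr0n act0.
  by rewrite mulrS actD; exact: orbit_hull_act.
elim: N => [|N IH]; first by rewrite big_ord1 invr1 scale1r; exact: hn 0%N.
have N1 : N.+1%:R != 0 :> R by rewrite pnatr_eq0.
have N2 : N.+2%:R != 0 :> R by rewrite pnatr_eq0.
have a0 : 0 <= N.+1%:R / N.+2%:R :> R by rewrite divr_ge0.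
have a1 : N.+1%:R / N.+2%:R <= 1 :> R.
  by rewrite ler_pdivrMr ?ltr0n// mul1r ler_nat.
have := orbit_hull_convex a0 a1 IH (hn N.+1).
rewrite scalerA mulrAC mulfV// mul1r.
have -> : 1 - N.+1%:R / N.+2%:R = N.+2%:R^-1 :> R.
  rewrite -[X in X - _](mulfV N2) -mulrBl -(natr1 N.+1) [_ + 1]addrC addrK.
  by rewrite mul1r.
by rewrite -scalerDr [\sum_(n < N.+2) _]big_ord_recr.
Qed.

(** Riesz's proof of the mean ergodic theorem: all long averages of a vector of
    almost minimal seminorm in the convex hull of the orbit are again in that
    hull, so by the parallelogram law they are close to that vector. *)
Lemma von_Neumann g f : hasmean (fun n => A (g *+ n) f).
Proof.
move=> e e0.
pose D := [set dot v v | v in orbit_hull g f].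
have D0 : has_inf D.
  split; first by exists (dot f f); exists f => //; exact: orbit_hull_base.
  by exists 0 => _ [v _ <-]; exact: dot_ge0.
have eta0 : 0 < (e / 4) ^+ 2 by rewrite exprn_gt0// divr_gt0.
have [_ [v hv <-] hlt] := inf_adherent eta0 D0.
have infle w : orbit_hull g f w -> inf D <= dot w w.
  by move=> hw; apply: ge_inf; [exact: D0.2|exists w].
exists v.
have -> : e = e / 2 + e / 2 by lra.
have e2 : 0 < e / 2 by rewrite divr_gt0.
(* Write [f = v - (v - f)]: the average of [v] is close to [v], and that of
   [v - f] is close to zero since [v] is in the hull. *)
rewrite -(subr0 v).
have H1 : mean_within (fun n => A (g *+ n) v) v (e / 2).
  apply: nearW => -[|N].
    by rewrite big_ord0 scale0r subr0 nrm0 mulr0.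
  have N1 : 0 < N.+1%:R :> R by rewrite ltr0n.
  set S := \sum_(n < _) _; pose a := N.+1%:R^-1 *: S.
  have ha : orbit_hull g f a by exact: orbit_hull_average.
  have -> : S - N.+1%:R *: v = N.+1%:R *: (a - v).
    by rewrite scalerBr scalerA mulfV ?scale1r ?gt_eqF.
  rewrite nrmZ ger0_norm ?(ltW N1)// mulrC ler_pM2r//.
  have av : dot a a <= dot v v.
    rewrite -!nrm_sqr ler_sqr ?nnegrE ?nrm_ge0//.
    rewrite nrmZ ger0_norm ?invr_ge0// mulrC ler_pdivrMr//.
    apply: le_trans (nrm_sum _ _ _) _.
    under eq_bigr do rewrite nrm_act.
    by rewrite sumr_const card_ord mulr_natr.
  have mid : inf D <= 4^-1 * dot (a + v) (a + v).
    have := @orbit_hull_convex g f 2^-1 a v _ _ ha hv.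
    have -> : 1 - 2^-1 = 2^-1 :> R by lra.
    rewrite -scalerDr => /(_ _ _)/infle; rewrite dotZl dotZr mulrA.
    have -> : 2^-1 * 2^-1 = 4^-1 :> R by lra.
    apply; lra.
  rewrite -ler_sqr ?nnegrE ?nrm_ge0//; last by rewrite ltW.
  rewrite nrm_sqr parallelogram; lra.
have H2 := mean_toN (orbit_hull_mean hv) e2.
rewrite oppr0 in H2.
have := mean_withinD H1 H2; rewrite addr0 subr0.
by rewrite /mean_within; under [X in X -> _]eq_near => N do
  under eq_bigr => n do rewrite opprB addrC subrK.
Qed.

End Actions.

(** * Completeness and the reduction to periodic vectors *)

Section Completeness.
Context (R : realType).
Implicit Types V W : preHilbert R.

Definition converges V (x : nat -> V) (y : V) : Prop :=
  forall e, 0 < e -> \forall n \near \oo, nrm (x n - y) <= e.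

Definition cauchy_seq V (x : nat -> V) : Prop :=
  forall e, 0 < e -> exists y, \forall n \near \oo, nrm (x n - y) <= e.

Definition complete V : Prop :=
  forall x : nat -> V, cauchy_seq x -> exists y, converges x y.

Lemma hasmean_complete V (x : nat -> V) : complete V -> hasmean x ->
  exists y, mean_to x y.
Proof.
move=> cV hx; have [|y hy] := cV (fun N => N%:R^-1 *: \sum_(n < N) x n).
  move=> e /hx[y hy]; exists y; near=> N.
  have N0 : (0 < N)%N by near: N; exact: nbhs_infty_gt.
  have N1 : 0 < N%:R :> R by rewrite ltr0n.
  by rewrite -(ler_pM2r N1) -nrm_average//; near: N.
exists y => e /hy h; near=> N.
have N0 : (0 < N)%N by near: N; exact: nbhs_infty_gt.
by rewrite nrm_average// ler_wpM2r//; near: N.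
Unshelve. all: by end_near. Qed.

Lemma mean_to_unique V (x : nat -> V) y y' :
  mean_to x y -> mean_to x y' -> nrm (y - y') = 0.
Proof.
move=> h h'; apply/eqP; rewrite eq_le nrm_ge0 andbT.
apply/ler_addgt0Pl => e e0; rewrite addr0.
have := mean_toD h (mean_toN h') e0.
have -> : (fun n => x n + - x n) = fun=> 0 by apply/funext => n; rewrite subrr.
move=> hN; near \oo => N.
have N0 : (0 < N)%N by near: N; exact: nbhs_infty_gt.
have : nrm (\sum_(n < N) (0 : V) - N%:R *: (y - y')) <= e * N%:R by near: N.
rewrite big1// sub0r nrmN nrmZ ger0_norm// mulrC ler_pM2r//.
by rewrite ltr0n.
Unshelve. all: by end_near. Qed.

Lemma dot_null V (x z : V) : nrm z = 0 -> dot x z = 0.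
Proof.
by move=> z0; apply/normr0_eq0/eqP; rewrite eq_le normr_ge0 andbT
  -(mulr0 (nrm x)) -z0 abs_dot_le.
Qed.

Section Rational.
Context V (cV : complete V) (U : isometric_action int V).
Implicit Types (f y z : V) (m : nat).

Let invariant (k : int) z := nrm (U k z - z) = 0.

Let invariantM m n z : invariant m%:Z z -> invariant (m * n)%N%:Z z.
Proof.
move=> h; elim: n => [|n IH]; first by rewrite muln0 /invariant act0 subrr nrm0.
apply/eqP; rewrite eq_le nrm_ge0 andbT mulnS PoszD actD.
apply: le_trans (nrm_triangle (U m%:Z z) _ _) _.
by rewrite -actVB nrm_act IH h addr0.
Qed.

Let dot_shift_invariant m f z n : invariant m%:Z z ->
  dot (U (m%:Z *+ n) f) z = dot f z.
Proof.
move=> /(@invariantM _ n).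
have -> : (m * n)%N%:Z = m%:Z *+ n by rewrite PoszM pmulrn mulrzz.
move=> h; rewrite -[in RHS](act_dot U (m%:Z *+ n)); apply/esym/eqP.
by rewrite -subr_eq0 -dotBr dot_null.
Qed.

Let mean_invariant m f y :
  mean_to (fun n => U (m%:Z *+ n) f) y -> invariant m%:Z y.
Proof.
move=> h; rewrite /invariant.
apply: (@mean_to_unique _ (fun n => U (m%:Z *+ n.+1) f)).
  apply: mean_to_ext (mean_to_act U m%:Z h) => n.
  by rewrite mulrS actD.
have uM n : nrm (U (m%:Z *+ n) f) <= nrm f by rewrite nrm_act.
have := mean_toD (mean0_shift_diff 1 uM) h; rewrite add0r.
by apply: mean_to_ext => n; rewrite addn1 subrK.
Qed.

Let mean_dot m f y z : mean_to (fun n => U (m%:Z *+ n) f) y ->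
  invariant m%:Z z -> dot (f - y) z = 0.
Proof.
move=> h hz; have h1 := mean_to_dot z h.
have : mean_to (V := realH R) (fun=> dot f z : realH R) (dot y z).
  by apply: mean_to_ext h1 => n; rewrite dot_shift_invariant.
move=> /(mean_to_unique (mean_to_cst (dot f z : realH R))).
by rewrite nrm_realH dotBl => /normr0_eq0.
Qed.

(** The projections of [f] to the vectors of period [k`!] grow with [k] in norm,
    hence converge; what remains of [f] after removing the limit has zero
    projection to the vectors of any period. A property that is closed under
    sums and limits thus only has to be checked on these two kinds of vectors. *)
Lemma rational_decomposition (Q : V -> Prop) :
  (forall f h, Q f -> Q h -> Q (f + h)) ->
  (forall f, (forall e, 0 < e -> exists2 h, Q h & nrm (f - h) <= e) -> Q f) ->
  (forall f m, (0 < m)%N -> nrm (U m%:Z f - f) = 0 -> Q f) ->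
  (forall f, (forall m, (0 < m)%N ->
      mean_to (fun n => U (m%:Z *+ n) f) 0) -> Q f) ->
  forall f, Q f.
Proof.
move=> QD Qcl Qrat Qmix f.
have /choice[p hp] m : exists y, mean_to (fun n => U (m%:Z *+ n) f) y.
  exact: hasmean_complete cV (von_Neumann U m%:Z f).
have pinv m : invariant m%:Z (p m) := mean_invariant (hp m).
have pinv' m n : (m <= n)%N -> invariant n`!%:Z (p m`!).
  by move=> mn; rewrite (fact_split mn); exact: invariantM.
have pdot m z : invariant m%:Z z -> dot f z = dot (p m) z.
  by move=> /(mean_dot (hp m))/eqP; rewrite dotBl subr_eq0 => /eqP.
pose N m := dot (p m`!) (p m`!).
have diff m n : (m <= n)%N ->
    dot (p n`! - p m`!) (p n`! - p m`!) = N n - N m.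
  move=> mn; have e1 : dot (p n`!) (p m`!) = N m.
    by rewrite -(pdot n`! _ (pinv' _ _ mn)) (pdot m`! _ (pinv _)).
  by rewrite dotBl !dotBr (dotC (p m`!)) e1 subrr subr0.
have Nub m : N m <= dot f f.
  have := dot_ge0 (f - p m`!); rewrite dotBl !dotBr (dotC _ f).
  by rewrite (pdot _ _ (pinv m`!)) -/(N m); lra.
have sN : has_sup (range N).
  by split; [exists (N 0%N); exists 0%N|exists (dot f f) => _ [m _ <-]].
have [|y hy] := @cV (fun m => p m`!).
  move=> e e0; have e2 : 0 < e ^+ 2 by rewrite exprn_gt0.
  have [_ [m _ <-] hm] := sup_adherent e2 sN.
  exists (p m`!); exists m => // n /= mn.
  rewrite -ler_sqr ?nnegrE ?nrm_ge0 ?(ltW e0)// nrm_sqr diff//.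
  have : N n <= sup (range N) by apply: ub_le_sup; [exact: sN.2|exists n].
  lra.
rewrite -(subrK y f); apply: QD.
  apply: Qmix => m m0.
  have [z hz] := hasmean_complete cV (von_Neumann U m%:Z (f - y)).
  have zinv := mean_invariant hz.
  suff z0 : nrm z = 0.
    move=> e e0; apply: filterS (hz e e0) => n; rewrite scaler0 subr0.
    set S := \sum_(_ < _) _; rewrite -[in X in _ -> X](subrK (n%:R *: z) S).
    move=> h; apply: le_trans (nrmD _ _) _.
    by rewrite nrmZ z0 mulr0 addr0.
  apply/eqP; rewrite -sqrf_eq0 nrm_sqr.
  have -> : dot z z = dot (f - y) z.
    have := mean_dot hz zinv; rewrite dotBl => /eqP; rewrite subr_eq0 => /eqP.
    by move=> ->.
  have limy : forall e, 0 < e -> `|dot (f - y) z| <= e * nrm z.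
    move=> e /hy h; near \oo => k.
    have mk : (m <= k)%N by near: k; exact: nbhs_infty_ge.
    have zk : invariant k`!%:Z z.
      have /dvdnP[q ->] : (m %| k`!)%N by rewrite dvdn_fact// m0.
      by rewrite mulnC; exact: invariantM.
    have -> : dot (f - y) z = dot (p k`! - y) z.
      by rewrite !dotBl (pdot k`!).
    apply: le_trans (abs_dot_le _ _) _; apply: ler_wpM2r; first exact: nrm_ge0.
    by near: k.
  rewrite -normr_eq0 eq_le normr_ge0 andbT.
  apply/ler_addgt0Pl => e e0; rewrite addr0.
  have z1 : 0 < nrm z + 1 by rewrite ltr_wpDl ?nrm_ge0.
  apply: le_trans (limy (e / (nrm z + 1)) (divr_gt0 e0 z1)) _.
  by rewrite mulrAC ler_pdivrMr// ler_pM2l// lerDl.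
apply: Qcl => e /hy h; near \oo => k.
exists (p k`!); last by rewrite nrmBC; near: k.
by apply: (Qrat _ k`!); rewrite ?fact_gt0//; exact: pinv.
Unshelve. all: by end_near. Qed.

End Rational.

Lemma sum_residues (V : zmodType) (x : nat -> V) q L :
  \sum_(n < q * L) x n = \sum_(r < q) \sum_(l < L) x (r + q * l)%N.
Proof.
elim: L => [|L IH].
  by rewrite muln0 big_ord0 big1// => r _; rewrite big_ord0.
under [RHS]eq_bigr do rewrite big_ord_recr/=.
rewrite big_split/= -IH mulnS addnC.
rewrite -(big_mkord xpredT x) (big_cat_nat (n := q * L))//= ?leq_addr//.
rewrite big_mkord; congr (_ + _).
rewrite -{1}(add0n (q * L)%N) big_addn addnC addnK big_mkord.
by apply: eq_bigr => i _.
Qed.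

(** An average is the mean of the averages over the residue classes, up to an
    incomplete last period. *)
Lemma mean_within_residues V (x : nat -> V) M q (y : nat -> V) e e' :
  (0 < q)%N -> 0 <= e -> e < e' -> (forall n, nrm (x n) <= M) ->
  (forall r, (r < q)%N -> mean_within (fun l => x (r + q * l)%N) (y r) e) ->
  mean_within x (q%:R^-1 *: \sum_(r < q) y r) e'.
Proof.
move=> q0 e0 ee' xM H.
set yb := q%:R^-1 *: _.
have q1 : q%:R != 0 :> R by rewrite pnatr_eq0 -lt0n.
have ybE : \sum_(r < q) y r = q%:R *: yb by rewrite scalerA mulfV// scale1r.
clearbody yb.
have : \forall L \near \oo, forall r : 'I_q,
    nrm (\sum_(l < L) x (r + q * l)%N - L%:R *: y r) <= e * L%:R.
  by apply: filter_forall => r; exact: H.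
move=> [L0 _ hL0]; near=> N.
pose L := (N %/ q)%N; have NE := divn_eq N q.
have hL := hL0 L _.
have L0L : (L0 <= L)%N.
  by rewrite leq_divRL//; near: N; exact: nbhs_infty_ge.
have rq : (N %% q < q)%N by rewrite ltn_mod.
have -> : \sum_(n < N) x n - N%:R *: yb
   = (\sum_(r < q) (\sum_(l < L) x (r + q * l)%N - L%:R *: y r))
     + (\sum_(n < N %% q) x (q * L + n)%N - (N %% q)%:R *: yb).
  rewrite sumrB -sum_residues -scaler_sumr.
  rewrite ybE scalerA addrACA -opprD -scalerDl -natrM -natrD -NE; congr (_ - _).
  rewrite -(big_mkord xpredT x) (big_cat_nat (n := q * L))//=; last first.
    by rewrite mulnC leq_divM.
  rewrite big_mkord; congr (_ + _).
  rewrite -{1}(add0n (q * L)%N) big_addn.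
  have -> : (N - q * L = N %% q)%N by rewrite {1}NE mulnC addKn.
  by rewrite big_mkord; apply: eq_bigr => i _; rewrite addnC.
apply: le_trans (nrmD _ _) _.
have h1 : nrm (\sum_(r < q) (\sum_(l < L) x (r + q * l)%N - L%:R *: y r))
    <= e * N%:R.
  apply: le_trans (nrm_sum _ _ _) _.
  apply: (@le_trans _ _ (\sum_(r < q) e * L%:R)).
    by apply: ler_sum => r _; exact: hL.
  rewrite sumr_const card_ord -mulrnAr ler_wpM2l// -mulrnA ler_nat.
  exact: leq_divM.
have M0 : 0 <= M := le_trans (nrm_ge0 _) (xM 0%N).
have rq' : (N %% q)%:R <= q%:R :> R by rewrite ler_nat ltnW.
have h2 : nrm (\sum_(n < N %% q) x (q * L + n)%N - (N %% q)%:R *: yb)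
    <= q%:R * (M + nrm yb).
  apply: le_trans (nrmB _ _) _; rewrite mulrDr lerD//.
    apply: le_trans (nrm_sum _ _ _) _.
    apply: (@le_trans _ _ (\sum_(n < N %% q) M)); first exact: ler_sum.
    by rewrite sumr_const card_ord -[leLHS]mulr_natl ler_wpM2r.
  by rewrite nrmZ ger0_norm// ler_wpM2r// nrm_ge0.
have h3 : q%:R * (M + nrm yb) <= (e' - e) * N%:R.
  by near: N; apply: near_le_natM; rewrite subr_gt0.
rewrite mulrBl in h3; lra.
Unshelve. all: by end_near. Qed.

Lemma mean0_residues V (x : nat -> V) M q : (0 < q)%N ->
  (forall n, nrm (x n) <= M) ->
  (forall r, (r < q)%N -> mean_to (fun l => x (r + q * l)%N) 0) ->
  mean_to x 0.
Proof.
move=> q0 xM H e e0.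
have e2 : 0 < e / 2 by rewrite divr_gt0.
have := @mean_within_residues _ x M q (fun=> 0) (e / 2) e q0 (ltW e2).
rewrite big1// scaler0; apply=> //; first by lra.
by move=> r rq; exact: H.
Qed.

Lemma hasmean_residues V (x : nat -> V) M q : (0 < q)%N ->
  (forall n, nrm (x n) <= M) ->
  (forall r, (r < q)%N -> hasmean (fun l => x (r + q * l)%N)) ->
  hasmean x.
Proof.
move=> q0 xM H e e0.
have e2 : 0 < e / 2 by rewrite divr_gt0.
have /choice[y hy] r : exists y, (r < q)%N ->
    mean_within (fun l => x (r + q * l)%N) y (e / 2).
  have [rq|_] := boolP (r < q)%N; last by exists 0.
  by have [y hy] := H r rq _ e2; exists y.
exists (q%:R^-1 *: \sum_(r < q) y r).
by apply: (@mean_within_residues _ x M q y (e / 2)) => //; [exact: ltW|lra].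
Qed.

End Completeness.

(** * Phases whose degree differs from that of the action *)

Section Twist.
Context (R : realType).
Implicit Types V : preHilbert R.

Definition trivial_action (G : zmodType) V : isometric_action G V.
Proof. by apply: (@IsometricAction _ _ _ (fun _ x => x)). Defined.

Let rot (G : zmodType) V (U : isometric_action G V) (p : R * G)
    (x : prodH V V) : prodH V V :=
  (cos p.1 *: U p.2 x.1 - sin p.1 *: U p.2 x.2,
   sin p.1 *: U p.2 x.1 + cos p.1 *: U p.2 x.2).

(** [V * V] is the complexification of [V]; the pair [(theta, g)] acts as the
    scalar [exp (i * theta)] times [g]. Twisting an action by a phase thus
    yields an action again. *)
Definition twisted_action (G : zmodType) V (U : isometric_action G V) :
  isometric_action (R * G)%type (prodH V V).
Proof.
apply: (@IsometricAction _ _ _ (rot U)) =>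
  [[t g] a x y|[t g] x y|x|[t g] [s h] x].
- rewrite /rot /=; congr (_, _).
    by rewrite !actVD !actVZ !scalerDr !scalerA !(mulrC _ a) opprD
      -!scalerA addrACA -scalerBr.
  by rewrite !actVD !actVZ !scalerDr !scalerA !(mulrC _ a) -!scalerA addrACA
    -scalerDr.
- rewrite /rot /= !(dotBl, dotDl, dotBr, dotDr, dotZl, dotZr) !act_dot.
  have := cos2Dsin2 t; set c := cos t; set s := sin t => cs.
  transitivity ((c ^+ 2 + s ^+ 2) * (dot x.1 y.1 + dot x.2 y.2)); first ring.
  by rewrite cs mul1r.
- rewrite /rot /= cos0 sin0 !act0 !scale1r !scale0r subr0 add0r.
  by case: x.
- rewrite /rot /= cosD sinD !actD !(actVD, actVN, actVZ).
  rewrite !(scalerDl, scalerDr, scaleNr, scalerN, scalerA, opprD, opprK).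
  congr (_, _).
    by rewrite [in LHS](addrC (- (sin t * cos s *: _))) addrACA.
  by rewrite [in LHS](addrC (cos t * cos s *: _)) addrACA.
Defined.

(** A geometric series: its partial sums stay bounded because [1 - exp (i * t)]
    is nonzero. *)
Lemma mean0_rotation (G : zmodType) V (U : isometric_action G V) t
    (x : prodH V V) : cos t != 1 ->
  mean_to (fun n => twisted_action U ((t, 0) *+ n) x) 0.
Proof.
move=> t1; have ct : 0 < 1 - cos t.
  by rewrite subr_gt0 lt_neqAle t1 cos_le1.
pose C := Num.sqrt (2 / (1 - cos t)) * nrm x.
apply: (@mean0_bounded_sums _ _ _ C) => N.
set S : prodH V V := \sum_(n < N) _; pose g : R * G := (t, 0).
set A := twisted_action U.
have e1 : A g S - S = A (g *+ N) x - x.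
  rewrite (big_morph (A g) (actVD A g) (actV0 A g)) -sumrB.
  have -> : \sum_(i < N) (A g (A (g *+ i) x) - A (g *+ i) x)
      = \sum_(0 <= i < N) (A (g *+ i.+1) x - A (g *+ i) x).
    by rewrite big_mkord; apply: eq_bigr => i _; rewrite mulrS actD.
  by rewrite (telescope_sumr (fun i => A (g *+ i) x))// mulr0n act0.
have e2 : dot (A g S) S = cos t * dot S S.
  move: (S) => [a b]; rewrite /= /rot /= !act0.
  by rewrite !(dotBl, dotDl, dotZl) (dotC b a); ring.
have e3 : nrm (A g S - S) ^+ 2 = 2 * (1 - cos t) * nrm S ^+ 2.
  by rewrite !nrm_sqr dotBl !dotBr act_dot (dotC S) e2; ring.
have e4 : nrm (A g S - S) <= 2 * nrm x.
  by rewrite e1; apply: le_trans (nrmB _ _) _; rewrite nrm_act; lra.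
rewrite -ler_sqr ?nnegrE ?nrm_ge0 ?mulr_ge0 ?sqrtr_ge0//.
rewrite exprMn [X in _ <= X * _]sqr_sqrtr ?divr_ge0 ?(ltW ct)//.
rewrite mulrAC ler_pdivlMr//.
have := nrm_ge0 (A g S - S); have := nrm_ge0 x; nra.
Qed.

(** The condition on the top coefficient [t], infinite order as an angle, is
    inherited by multiples and by restrictions to residue classes. *)
Definition free_phase (d : nat) (phi : nat -> R) : Prop :=
  exists2 t, forall m, (0 < m)%N -> cos (t *+ m) != 1 & is_poly d t phi.

(** By the second clause [U (u n)] is constant along the residue classes modulo
    [m] on vectors of period [m]. *)
Definition integer_poly (g : nat) (u : nat -> int) : Prop :=
  (exists2 k, (0 < k)%N & is_poly g k%:Z u) /\
  (forall r m l, exists z : int, u (r + m * l)%N = u r + m%:Z * z).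

Lemma free_phase_dilate d phi r q : (0 < q)%N -> free_phase d phi ->
  free_phase d (fun n => phi (r + q * n)%N).
Proof.
move=> q0 [t ht H]; exists (t *+ q ^ d); last exact: is_poly_dilate.
by move=> m m0; rewrite -mulrnA ht// muln_gt0 expn_gt0 q0 m0.
Qed.

Lemma free_phaseMn d phi k : (0 < k)%N -> free_phase d phi ->
  free_phase d (fun n => phi n *+ k).
Proof.
move=> k0 [t ht H]; exists (t *+ k).
  by move=> m m0; rewrite -mulrnA ht// muln_gt0 k0.
rewrite -mulr_natl; apply: is_poly_ext (is_poly_scale k%:R H) => n.
by rewrite mulr_natl.
Qed.

Lemma free_phaseD d phi a : free_phase d.+1 phi ->
  free_phase d.+1 (fun n => phi n + a).
Proof. by move=> [t ht H]; exists t => //; exact: is_poly_const. Qed.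

Lemma integer_poly_dilate g u r q : (0 < q)%N -> integer_poly g u ->
  integer_poly g (fun n => u (r + q * n)%N).
Proof.
move=> q0 [[k k0 H] cu]; split; last first.
  move=> r' m l; have [z hz] := cu (r + q * r')%N m (q * l)%N.
  by exists z; rewrite -hz; congr u; lia.
exists (k * q ^ g)%N; first by rewrite muln_gt0 k0 expn_gt0 q0.
have -> : (k * q ^ g)%N%:Z = k%:Z *+ q ^ g by rewrite PoszM pmulrn mulrzz.
exact: is_poly_dilate.
Qed.

Lemma mean0_free_phase V d phi (f : V) : (0 < d)%N -> free_phase d phi ->
  mean_to (fun n => cos (phi n) *: f) 0.
Proof.
case: d => // d _ [t ht H].
pose A := twisted_action (trivial_action int V).
have hA : mean_to (fun n => A (phi n, 0) (f, 0)) 0.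
  apply: mean0_polynomial (is_poly_pair H (is_poly_zero _ _)) _ => m m0.
  apply: mean_to_ext (mean0_rotation (trivial_action int V) (f, 0) (ht m m0)) => n.
  by rewrite !pair_mulrn !mul0rn.
apply: mean_to_ext (mean_to_fst hA) => n.
by rewrite /= scaler0 subr0.
Qed.

Section Integers.
Context V (cV : complete V) (U : isometric_action int V).

Lemma act_period m (z : int) (f : V) : nrm (U m%:Z f - f) = 0 ->
  nrm (U (m%:Z * z) f - f) = 0.
Proof.
move=> h.
have nat_case n : nrm (U (m%:Z * n%:Z) f - f) = 0.
  elim: n => [|n IH]; first by rewrite mulr0 act0 subrr nrm0.
  apply/eqP; rewrite eq_le nrm_ge0 andbT intS mulrDr mulr1 actD.
  apply: le_trans (nrm_triangle (U m%:Z f) _ _) _.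
  by rewrite -actVB nrm_act IH h addr0.
case: (intP z) => [|n|n].
- by rewrite mulr0 act0 subrr nrm0.
- exact: nat_case.
- rewrite mulrN -(nrm_act U (m%:Z * n.+1%:Z)) actVB -actD subrr act0.
  by rewrite nrmBC nat_case.
Qed.

(** When the phase has the larger degree it alone decides the top coefficient,
    whose powers average to zero. When the action has the larger degree, the
    vectors without periodic part are handled by the action alone, and on a
    vector of period [m] the action is constant along each residue class, so
    that only the phase remains. *)
Lemma mean0_twisted d g phi u f : (0 < d)%N -> (0 < g)%N -> d != g ->
  free_phase d phi -> integer_poly g u ->
  mean_to (fun n => cos (phi n) *: U (u n) f) 0.
Proof.
move=> d0 g0 dg fphi iu.
have ubound n (h : V) : nrm (cos (phi n) *: U (u n) h) <= nrm h.
  by rewrite nrmZ nrm_act ler_piMl ?nrm_ge0// ler_norml cos_geN1 cos_le1.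
have [t ht Hphi] := fphi; have [[k k0 Hu] cu] := iu.
move: f; pose A := twisted_action U.
have fstA (h : V) : mean_to (fun n => A (phi n, u n) (h, 0)) 0 ->
    mean_to (fun n => cos (phi n) *: U (u n) h) 0.
  move=> /mean_to_fst; apply: mean_to_ext => n.
  by rewrite /= actV0 scaler0 subr0.
case: d d0 fphi Hphi dg => // d _ fphi Hphi.
case: g g0 Hu {iu} => // g _ Hu.
rewrite neq_ltn => /orP[dg|gd]; last first.
  move=> f; apply: fstA.
  apply: mean0_polynomial (is_poly_pair Hphi (is_poly_weaken gd Hu)) _ => m m0.
  apply: mean_to_ext (mean0_rotation U (f, 0) (ht m m0)) => n.
  by rewrite !pair_mulrn !mul0rn.
apply: (@rational_decomposition _ _ cV U
  (fun f => mean_to (fun n => cos (phi n) *: U (u n) f) 0)).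
- move=> f h hf hh; have := mean_toD hf hh; rewrite addr0.
  by apply: mean_to_ext => n; rewrite actVD scalerDr.
- move=> f cl; apply: mean_to_approx_unif => e /cl[h hh fh].
  exists (fun n => cos (phi n) *: U (u n) h) => //.
  move=> n.
  by rewrite -scalerBr -actVB; exact: le_trans fh.
- move=> f m m0 per.
  apply: (@mean0_residues _ _ _ (nrm f) m m0) => [n|r _]; first exact: ubound.
  apply: mean_to_approx_unif => e e0.
  exists (fun l => cos (phi (r + m * l)%N) *: U (u r) f).
    exact: mean0_free_phase (free_phase_dilate r m0 fphi).
  move=> l.
  have [z ->] := cu r m l.
  rewrite -scalerBr actD -actVB nrmZ nrm_act act_period// mulr0 ltW//.
- move=> f mix; apply: fstA.
  apply: mean0_polynomial (is_poly_pair (is_poly_weaken dg Hphi) Hu) _ => m m0.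
  have := mix (k * m)%N; rewrite muln_gt0 k0 m0 => /(_ isT).
  move=> /(@mean_to_image _ V (prodH V V) (fun v => (v, 0))) h.
  apply: mean_to_ext (h _ _) => [n|a x y|v].
  + rewrite !pair_mulrn !mul0rn /A /= /rot /= cos0 sin0 !scale1r !scale0r subr0 add0r.
    rewrite actV0 /= PoszM; congr (U (_ *+ _) _, _).
    by rewrite pmulrn mulrzz.
  + change ((a *: x + y, 0) = (a *: x + y, a *: 0 + 0) :> V * V).
    by rewrite scaler0 addr0.
  + by have := nrm_prodH_le (v, 0 : V); rewrite /= nrm0 addr0.
Qed.

Lemma hasmean_integer_poly g u f : (0 < g)%N -> integer_poly g u ->
  hasmean (fun n => U (u n) f).
Proof.
case: g => // g _ [[k k0 Hu] cu]; move: f.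
apply: (@rational_decomposition _ _ cV U
  (fun f => hasmean (fun n => U (u n) f))).
- move=> f h hf hh.
  by apply: hasmean_ext (hasmeanD hf hh) => n; rewrite actVD.
- move=> f cl; apply: hasmean_approx_unif => e /cl[h hh fh].
  exists (fun n => U (u n) h) => //.
  by move=> n; rewrite -actVB nrm_act.
- move=> f m m0 per.
  apply: (@hasmean_residues _ _ _ (nrm f) m m0) => [n|r _].
    by rewrite nrm_act.
  apply: hasmean_approx_unif => e e0; exists (fun=> U (u r) f).
    exact: mean_to_hasmean (mean_to_cst _).
  move=> l.
  have [z ->] := cu r m l.
  by rewrite actD -actVB nrm_act act_period// ltW.
- move=> f mix; apply: mean_to_hasmean (mean0_polynomial Hu _) => m m0.
  have := mix (k * m)%N; rewrite muln_gt0 k0 m0 => /(_ isT).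
  apply: mean_to_ext => n; congr (U (_ *+ _) _).
  by rewrite PoszM pmulrn mulrzz.
Qed.

End Integers.

End Twist.

(** * The sign of a cosine as a limit of odd polynomials *)

Section Sign.
Context (R : realType).
Implicit Types V : preHilbert R.

Lemma cosM_cosMn (x : R) k :
  cos x * cos (x *+ k.+1) = 2^-1 * cos (x *+ k.+2) + 2^-1 * cos (x *+ k).
Proof.
have -> : x *+ k.+2 = x *+ k.+1 + x by rewrite [LHS]mulrSr.
have -> : x *+ k = x *+ k.+1 - x by rewrite mulrSr addrK.
rewrite cosB cosD; lra.
Qed.

Section Moments.
Context V (phi : nat -> R) (y : nat -> V).
Hypothesis free : forall k, (0 < k)%N ->
  mean_to (fun n => cos (phi n *+ k) *: y n) 0.

(** The frequencies in [cos x ^ j * cos (x *+ k)] have the parity of [j + k], so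
    that zero is not among them. *)
Lemma mean0_odd_moment j k : odd (j + k) ->
  mean_to (fun n => (cos (phi n) ^+ j * cos (phi n *+ k)) *: y n) 0.
Proof.
elim: j k => [|j IH] [|k] //=.
- move=> _; apply: mean_to_ext (free (ltn0Sn k)) => n.
  by rewrite expr0 mul1r.
- rewrite addn0 => jo; have := IH 1%N; rewrite addn1 => /(_ jo).
  apply: mean_to_ext => n.
  by rewrite mulr1n mulr0n cos0 mulr1 exprSr.
- rewrite addnS /= negbK => jk.
  have := mean_toD (mean_toZ 2^-1 (IH k.+2 _)) (mean_toZ 2^-1 (IH k jk)).
  rewrite !scaler0 addr0 !addnS/= negbK => /(_ jk).
  apply: mean_to_ext => n; rewrite !scalerA -scalerDl; congr (_ *: _).
  by rewrite exprSr -!mulrA cosM_cosMn; lra.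
Qed.

Lemma mean0_odd_polynomial (q : {poly R}) :
  mean_to (fun n => (cos (phi n) * q.[cos (phi n) ^+ 2]) *: y n) 0.
Proof.
have : mean_to (fun n => \sum_(i < size q)
    q`_i *: ((cos (phi n) ^+ i.*2.+1 * cos (phi n *+ 0)) *: y n)) 0.
  apply: mean_to_sum => i _; rewrite -(scaler0 V q`_i); apply: mean_toZ.
  by apply: mean0_odd_moment; rewrite addn0 /= odd_double.
apply: mean_to_ext => n; rewrite horner_coef mulr_sumr scaler_suml.
apply: eq_bigr => i _; rewrite scalerA; congr (_ *: _).
by rewrite mulr0n cos0 mulr1 exprS -exprM -mul2n; ring.
Qed.

End Moments.

(** The limit is the constant term of the expansion: [2 ^ j * cos x ^ j] is the sum
    of [exp (i * x)] to the power [j - 2 * m], with multiplicity ['C(j, m)]. *)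
Lemma mean_even_moment (phi : nat -> R) j k i :
  (forall k, (0 < k)%N ->
     mean_to (V := realH R) (fun n => cos (phi n *+ k)) 0) ->
  (j + k = i.*2)%N ->
  mean_to (V := realH R) (fun n => cos (phi n) ^+ j * cos (phi n *+ k))
    (2^-1 ^+ j * 'C(j, i)%:R).
Proof.
move=> free; elim: j k i => [|j IH] [|k] i.
- move=> /eqP; rewrite addn0 eq_sym double_eq0 => /eqP->.
  rewrite bin0 mulr1 expr0.
  apply: mean_to_ext (mean_to_cst (1 : realH R)) => n.
  by rewrite mulr0n cos0 mulr1.
- case: i => // i _; rewrite bin0n mulr0.
  by apply: mean_to_ext (free k.+1 isT) => n; rewrite expr0 mul1r.
- rewrite addn0; case: i => // i ji; have := IH 1%N i.+1.
  rewrite addn1 => /(_ ji).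
  have -> : 2^-1 ^+ j.+1 * 'C(j.+1, i.+1)%:R = 2^-1 ^+ j * 'C(j, i.+1)%:R :> R.
    rewrite binS natrD exprSr; suff -> : 'C(j, i) = 'C(j, i.+1) by field.
    by rewrite -bin_sub; [congr 'C(_, _)|]; lia.
  by apply: mean_to_ext => n; rewrite mulr1n mulr0n cos0 mulr1 exprSr.
- case: i => [|i]; first by rewrite addnS.
  rewrite addnS addSn doubleS => -[jk].
  have := mean_toD (mean_toZ (2^-1 : R) (IH k.+2 i.+1 _))
    (mean_toZ (2^-1 : R) (IH k i jk)).
  rewrite !addnS doubleS jk => /(_ erefl).
  have -> : (2^-1 *: (2^-1 ^+ j * 'C(j, i.+1)%:R : realH R)
      + 2^-1 *: (2^-1 ^+ j * 'C(j, i)%:R : realH R) : realH R)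
      = 2^-1 ^+ j.+1 * 'C(j.+1, i.+1)%:R.
    change (2^-1 * (2^-1 ^+ j * 'C(j, i.+1)%:R) + 2^-1 * (2^-1 ^+ j * 'C(j, i)%:R)
      = 2^-1 ^+ j.+1 * 'C(j.+1, i.+1)%:R :> R).
    by rewrite binS natrD exprS; ring.
  apply: mean_to_ext => n.
  change (2^-1 * (cos (phi n) ^+ j * cos (phi n *+ k.+2))
     + 2^-1 * (cos (phi n) ^+ j * cos (phi n *+ k))
     = cos (phi n) ^+ j.+1 * cos (phi n *+ k.+1)).
  by rewrite exprSr -[in RHS]mulrA cosM_cosMn; ring.
Qed.

(** The mean of [cos ^ (2 * m)] over the circle. *)
Definition central (m : nat) : R := 2^-1 ^+ m.*2 * 'C(m.*2, m)%:R.

Lemma central_ge0 m : 0 <= central m.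
Proof. by rewrite mulr_ge0// exprn_ge0. Qed.

Lemma central_rec m : central m.+1 * m.+1.*2%:R = central m * m.*2.+1%:R.
Proof.
have H : ('C(m.*2.+2, m.+1) * m.+1 = 'C(m.*2, m) * m.*2.+1 * 2)%N.
  have h1 := mul_bin_diag m.*2.+2 m; have h2 := mul_bin_diag m.*2.+1 m.
  have h3 : 'C(m.*2.+1, m.+1) = 'C(m.*2.+1, m).
    by rewrite -bin_sub; [congr 'C(_, _)|]; lia.
  rewrite /= -h3 -addnn in h1 h2 *; rewrite -addnn in h3; nia.
have {}H : 'C(m.*2.+2, m.+1)%:R * m.+1%:R = 'C(m.*2, m)%:R * m.*2.+1%:R * 2 :> R.
  by rewrite -!natrM H.
have -> : m.+1.*2%:R = 2 * m.+1%:R :> R by rewrite -mul2n natrM.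
rewrite /central doubleS 2!exprS.
move: H; set a := 'C(_, _)%:R; set b := m.+1%:R; set c := 2^-1 ^+ _ => H.
have -> : 2^-1 * (2^-1 * c) * a * (2 * b) = 2^-1 * c * (a * b) by field.
by rewrite H; field.
Qed.

Lemma central_sqr_le m : central m ^+ 2 * m.*2.+1%:R <= 1.
Proof.
elim: m => [|m IH]; first by rewrite /central expr0 bin0 mul1r expr1n mul1r.
have h := central_rec m.
have k0 : 0 < m.+1.*2%:R :> R by rewrite ltr0n double_gt0.
have e1 : central m.+1 = central m * m.*2.+1%:R / m.+1.*2%:R.
  by rewrite -h mulfK// gt_eqF.
rewrite e1 exprMn exprVn mulrAC ler_pdivrMr ?exprn_gt0// mul1r.
have a0 := sqr_ge0 (central m).
have b0 : 0 <= m.*2.+1%:R :> R by [].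
have -> : m.+1.*2%:R = m.*2.+1%:R + 1 :> R by rewrite doubleS -natr1.
have -> : m.+1.*2.+1%:R = m.*2.+1%:R + 2 :> R 
  by rewrite doubleS -(natr1 m.*2.+2) -(natr1 m.*2.+1) -addrA.
move: (m.*2.+1%:R) b0 IH => b b0 IH.
have : central m ^+ 2 * b * (b * (b + 2)) <= b * (b + 2).
  by rewrite ler_piMl// mulr_ge0// addr_ge0.
lra.
Qed.

Lemma central_small e : 0 < e -> exists k, central (2 ^ k) <= e.
Proof.
move=> e0; have e2 : 0 < e ^+ 2 by rewrite exprn_gt0.
have [n0 _ hn0] := near_le_natM 1 e2.
exists n0; have hk : (n0 <= (2 ^ n0).*2.+1)%N.
  have := ltn_expl n0 (isT : 1 < 2)%N; lia.
have := hn0 _ hk; have := central_sqr_le (2 ^ n0).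
have c0 := central_ge0 (2 ^ n0).
move=> h1 h2; rewrite -ler_sqr ?nnegrE ?(ltW e0)//.
have p0 : 0 < (2 ^ n0).*2.+1%:R :> R by [].
by rewrite -(ler_pM2r p0); apply: le_trans h1 h2.
Qed.

(** Newton's iteration for the sign function: on [-1, 1] it preserves the sign,
    and the defect [1 - p ^+ 2] is at least squared at each step. *)
Fixpoint newton (k : nat) (y : R) : R :=
  if k is k'.+1 then (3 * newton k' y - newton k' y ^+ 3) / 2 else y.

Lemma newton_odd k : exists q : {poly R}, forall y, newton k y = y * q.[y ^+ 2].
Proof.
elim: k => [|k [q hq]]; first by exists 1 => y; rewrite hornerC mulr1.
exists ((3 / 2) *: q - 2^-1 *: ('X * q ^+ 3)) => y.
by rewrite /= hq hornerD hornerN !hornerZ hornerM hornerX horner_exp; field.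
Qed.

Lemma newton_bounds k y : -1 <= y <= 1 ->
  [/\ -1 <= newton k y <= 1, 0 <= y -> 0 <= newton k y,
      y <= 0 -> newton k y <= 0 &
      1 - newton k y ^+ 2 <= (1 - y ^+ 2) ^+ (2 ^ k)].
Proof.
move=> /andP[y1 y2]; elim: k => [|k [/andP[p1 p2] pp pn pd]] /=.
  by split => //; rewrite ?y1 ?y2// expn0 expr1.
move: (newton k y) p1 p2 pp pn pd => p p1 p2 pp pn pd.
split.
- have := mulr_ge0 (sqr_ge0 (p - 1)) (_ : 0 <= p + 2).
  have := mulr_ge0 (sqr_ge0 (p + 1)) (_ : 0 <= 2 - p).
  move=> h1 h2; have {}h1 := h1 ltac:(lra); have {}h2 := h2 ltac:(lra).
  rewrite -subr_ge0 in h1; apply/andP; split; lra.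
- move=> /pp p0; have : 0 <= p * (3 - p ^+ 2) by rewrite mulr_ge0//; nra.
  by lra.
- move=> /pn p0; have : 0 <= (- p) * (3 - p ^+ 2) by rewrite mulr_ge0//; nra.
  by lra.
- have d0 : 0 <= 1 - p ^+ 2 by nra.
  have -> : 1 - ((3 * p - p ^+ 3) / 2) ^+ 2
      = (1 - p ^+ 2) ^+ 2 * (1 - p ^+ 2 / 4) by field.
  rewrite expnSr exprM; apply: (@le_trans _ _ ((1 - p ^+ 2) ^+ 2)).
    by rewrite ler_piMr ?sqr_ge0//; have := sqr_ge0 p; lra.
  by rewrite ler_sqr// nnegrE//; exact: le_trans d0 pd.
Qed.

(** Always [1] or [-1], unlike [Num.sg]. *)
Definition sgn (y : R) : R := if 0 <= y then 1 else -1.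

Lemma sgn_newton k y : -1 <= y <= 1 ->
  `|sgn y - newton k y| <= (1 - y ^+ 2) ^+ (2 ^ k).
Proof.
move=> /(newton_bounds k)[/andP[p1 p2] pp pn]; apply: le_trans.
rewrite /sgn; case: (leP 0 y) => [/pp|/ltW/pn] p0; rewrite ler_norml;
  apply/andP; split; nra.
Qed.

(** Newton's approximants are odd polynomials, so the hypothesis on the
    frequencies applies to them. The error is at most a high even power of
    [sin (phi n)], whose mean is a small [central] coefficient because
    [phi - pi / 2] is a free phase as well. *)
Lemma mean0_sgn V d (phi : nat -> R) (y : nat -> V) M : (0 < d)%N ->
  free_phase d phi -> (forall n, nrm (y n) <= M) ->
  (forall k, (0 < k)%N -> mean_to (fun n => cos (phi n *+ k) *: y n) 0) ->
  mean_to (fun n => sgn (cos (phi n)) *: y n) 0.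
Proof.
move=> d0 fphi yM free; apply: mean_to_approx => e e0.
have M0 : 0 <= M := le_trans (nrm_ge0 _) (yM 0%N).
have M1 : 0 < M + 1 by rewrite ltr_wpDl.
have e2 : 0 < e / 2 / (M + 1) by rewrite !divr_gt0.
have [k hk] := central_small e2; set m := (2 ^ k)%N in hk *.
exists (fun n => newton k (cos (phi n)) *: y n).
  have [q hq] := newton_odd k.
  by apply: mean_to_ext (mean0_odd_polynomial free q) => n; rewrite hq.
pose psi n := phi n + - (pi / 2).
have cospsi n : cos (psi n) = sin (phi n).
  exact: cosBpihalf.
have fpsi : free_phase d psi by case: d d0 fphi {free} => // d _; exact: free_phaseD.
have := @mean_even_moment psi m.*2 0 m.
rewrite addn0 -/(central m) => /(_ _ erefl) h.
have {}h : mean_to (V := realH R) (fun n => (1 - cos (phi n) ^+ 2) ^+ m)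
    (central m).
  apply: mean_to_ext (h _) => [n|j j0].
    by rewrite mulr0n cos0 mulr1 cospsi -muln2 mulnC exprM sin2cos2.
  have := mean0_free_phase (1 : realH R) d0 (free_phaseMn j0 fpsi).
  by apply: mean_to_ext => n; exact: mulr1.
have := h _ e2; rewrite /mean_within => hN.
near=> N.
have : nrm (\sum_(n < N) ((1 - cos (phi n) ^+ 2) ^+ m : realH R)
    - N%:R *: (central m : realH R)) <= e / 2 / (M + 1) * N%:R.
  by near: N.
rewrite nrm_realH => /ler_normlP[_].
change (\sum_(n < N) ((1 - cos (phi n) ^+ 2) ^+ m) - N%:R * central m
   <= e / 2 / (M + 1) * N%:R -> \sum_(n < N)
   nrm (sgn (cos (phi n)) *: y n - newton k (cos (phi n)) *: y n) <= e * N%:R).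
move=> hS.
apply: (@le_trans _ _ (\sum_(n < N) (1 - cos (phi n) ^+ 2) ^+ m * (M + 1))).
  apply: ler_sum => n _; rewrite -scalerBl nrmZ ler_pM ?nrm_ge0//.
    by apply: sgn_newton; rewrite cos_geN1 cos_le1.
  by apply: le_trans (yM n) _; rewrite lerDl.
rewrite -mulr_suml -ler_pdivlMr//.
have : N%:R * central m <= N%:R * (e / 2 / (M + 1)) by rewrite ler_wpM2l.
move: hS; set S := \sum_(_ < _) _.
have -> : e * N%:R / (M + 1) = 2 * (e / 2 / (M + 1) * N%:R) by field; rewrite gt_eqF.
lra.
Unshelve. all: by end_near. Qed.

End Sign.

(** * Alternating blocks and levels *)

Section Blocks.
Context (R : realType).
Implicit Types V : preHilbert R.

(** Constant on each block [2 ^ j <= n < 2 ^ j.+1]. The blocks grow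
    geometrically, slowly enough for [mean0_alt] and fast enough for
    [alt_not_hasmean]. *)
Definition alt (n : nat) : R := (-1) ^+ trunc_log 2 n.

Lemma sum_block V (x : nat -> V) j N : (2 ^ j <= N <= 2 ^ j.+1)%N ->
  \sum_(n < N) alt n *: x n - \sum_(n < 2 ^ j) alt n *: x n
  = (-1) ^+ j *: (\sum_(n < N) x n - \sum_(n < 2 ^ j) x n).
Proof.
move=> /andP[jN Nj].
have split (y : nat -> V) : \sum_(n < N) y n - \sum_(n < 2 ^ j) y n
    = \sum_(2 ^ j <= n < N) y n.
  rewrite -(big_mkord xpredT y) (big_cat_nat (n := (2 ^ j)%N))//=.
  by rewrite big_mkord [LHS]addrC addKr.
rewrite (split (fun n => alt n *: x n)) split scaler_sumr.
apply: eq_big_nat => n /andP[jn nN]; congr (_ ^+ _ *: _).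
by apply: trunc_log_eq => //; rewrite jn (leq_trans nN).
Qed.

(** Earlier blocks are geometrically smaller, so that their contributions stay
    of the order of the last one. *)
Lemma mean0_alt V (x : nat -> V) : mean_to x 0 ->
  mean_to (fun n => alt n *: x n) 0.
Proof.
move=> /mean0P hx; apply/mean0P => e e0.
have d0 : 0 < e / 16 by rewrite divr_gt0.
have [n0 _ hn0] := hx _ d0; set d := e / 16 in d0 hn0.
pose S N := nrm (\sum_(n < N) x n).
pose Y N := \sum_(n < N) alt n *: x n.
pose K := nrm (Y (2 ^ n0)%N).
have K0 : 0 <= K := nrm_ge0 _.
have step j N : (n0 <= j)%N -> (2 ^ j <= N <= 2 ^ j.+1)%N ->
    nrm (Y N) <= nrm (Y (2 ^ j)%N) + 3 * d * (2 ^ j)%:R.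
  move=> n0j hN; have /andP[jN Nj] := hN.
  have n0N : (n0 <= 2 ^ j)%N.
    by apply: leq_trans n0j _; rewrite ltnW// ltn_expl.
  have h1 := hn0 N (leq_trans n0N jN); have h2 := hn0 _ n0N.
  rewrite -(subrK (Y (2 ^ j)%N) (Y N)) /Y sum_block// addrC.
  apply: le_trans (nrmD _ _) _; rewrite lerD2l nrmZ normrX normrN1 expr1n mul1r.
  apply: le_trans (nrmB _ _) _.
  have h3 : d * N%:R <= d * (2 * (2 ^ j)%:R).
    by rewrite ler_pM2l// -natrM ler_nat -expnS.
  lra.
have claim k : nrm (Y (2 ^ (n0 + k))%N) <= K + 4 * d * (2 ^ (n0 + k))%:R.
  elim: k => [|k IH].
    by rewrite addn0 lerDl mulr_ge0// mulr_ge0// ltW.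
  have := step (n0 + k)%N (2 ^ (n0 + k.+1))%N (leq_addr _ _).
  rewrite addnS leqnn leq_exp2l// leqnSn => /(_ isT) h.
  apply: le_trans h _; rewrite expnS natrM.
  have : 0 <= d * (2 ^ (n0 + k))%:R by rewrite mulr_ge0// ltW.
  lra.
near=> N.
have N1 : (2 ^ n0 <= N)%N by near: N; exact: nbhs_infty_ge.
have N0 : (0 < N)%N by apply: leq_trans N1; rewrite expn_gt0.
have /andP[t1 t2] := trunc_log_bounds (isT : 1 < 2)%N N0.
have n0t : (n0 <= trunc_log 2 N)%N by exact: trunc_log_max.
have := claim (trunc_log 2 N - n0)%N; rewrite subnKC// => c.
have := step _ N n0t; rewrite t1 ltnW// => /(_ isT) h.
have KN : K <= d * N%:R by near: N; exact: near_le_natM.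
have dN : d * (2 ^ trunc_log 2 N)%:R <= d * N%:R by rewrite ler_pM2l// ler_nat.
have eN : e * N%:R = 16 * (d * N%:R) by rewrite /d; field.
have dN0 : 0 <= d * N%:R by rewrite mulr_ge0// ltW.
rewrite eN; apply: le_trans h _; lra.
Unshelve. all: by end_near. Qed.

(** If the averages of [alt n * y n] were close to [l], then so would be its
    averages over single blocks; but these are positive on the blocks of even
    rank and negative on the others, and bounded away from zero by [z]. *)
Lemma alt_not_hasmean (y z : nat -> R) c : 0 < c -> (forall n, z n <= y n) ->
  mean_to (V := realH R) z c ->
  ~ hasmean (V := realH R) (fun n => alt n * y n).
Proof.
move=> c0 zy hz hy.
have e0 : 0 < c / 12 by rewrite divr_gt0.
have [l hl] := hy _ e0; have := hz _ e0; set e := c / 12 in e0 hl *.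
move=> [n0 _ h0]; case: hl => n1 _ h1.
pose Y N := \sum_(n < N) alt n * y n; pose Z N := \sum_(n < N) z n.
have bY N : (n1 <= N)%N -> `|Y N - N%:R * (l : R)| <= e * N%:R.
  by move=> /h1; rewrite nrm_realH.
have bZ N : (n0 <= N)%N -> `|Z N - N%:R * c| <= e * N%:R.
  by move=> /h0; rewrite nrm_realH.
have key j : (n0 + n1 <= j)%N -> 6 * e <= (-1) ^+ j * l.
  move=> hj; have jj : (j <= 2 ^ j)%N by rewrite ltnW// ltn_expl.
  have p0 : 0 < (2 ^ j)%:R :> R by rewrite ltr0n expn_gt0.
  have b1 : (2 ^ j <= 2 ^ j.+1 <= 2 ^ j.+1)%N by rewrite leqnn leq_exp2l// leqnSn.
  have := @sum_block (realH R) y j _ b1.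
  rewrite -/(Y _) => E.
  have {}E : Y (2 ^ j.+1)%N - Y (2 ^ j)%N
     = (-1) ^+ j * (\sum_(n < 2 ^ j.+1) y n - \sum_(n < 2 ^ j) y n) by exact: E.
  have ZY : Z (2 ^ j.+1)%N - Z (2 ^ j)%N
      <= \sum_(n < 2 ^ j.+1) y n - \sum_(n < 2 ^ j) y n.
    have sp (x : nat -> R) : \sum_(n < 2 ^ j.+1) x n - \sum_(n < 2 ^ j) x n
        = \sum_(2 ^ j <= n < 2 ^ j.+1) x n.
      rewrite -(big_mkord xpredT x) (big_cat_nat (n := (2 ^ j)%N))//=.
        by rewrite big_mkord [LHS]addrC addKr.
      by rewrite leq_exp2l.
    by rewrite /Z !sp; apply: ler_sum.
  have a1 := bY (2 ^ j)%N ltac:(lia).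
  have a2 := bY (2 ^ j.+1)%N ltac:(rewrite expnS; lia).
  have a3 := bZ (2 ^ j)%N ltac:(lia).
  have a4 := bZ (2 ^ j.+1)%N ltac:(rewrite expnS; lia).
  have q : (2 ^ j.+1)%:R = 2 * (2 ^ j)%:R :> R by rewrite expnS natrM.
  rewrite q in a2 a4.
  have eE : c = 12 * e by rewrite /e; field.
  move: (Z (2 ^ j.+1)%N) (Z (2 ^ j)%N) (Y (2 ^ j.+1)%N) (Y (2 ^ j)%N) ZY E
    a1 a2 a3 a4 => Z2 Z1 Y2 Y1.
  move: (\sum_(n < 2 ^ j.+1) y n - _) => D ZY E /ler_normlP[a1 a1'] /ler_normlP[a2 a2']
    /ler_normlP[a3 a3'] /ler_normlP[a4 a4'].
  rewrite -(ler_pM2r p0); rewrite eE in a3 a3' a4 a4'.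
  have : (-1) ^+ j = 1 :> R \/ (-1) ^+ j = -1 :> R.
    by rewrite -signr_odd; case: odd; [right|left]; rewrite ?expr1 ?expr0.
  by case=> sE; rewrite sE in E *; lra.
have k1 := key (2 * (n0 + n1))%N ltac:(lia).
have k2 := key (2 * (n0 + n1)).+1%N ltac:(lia).
move: k1 k2; rewrite -signr_odd -[in X in _ -> X]signr_odd /= mul2n odd_double.
rewrite expr0 expr1; lra.
Qed.

Definition level (n : nat) : nat := logn 2 n.+1.

Lemma level_ge C n : (C <= level n)%N = (2 ^ C %| n.+1)%N.
Proof. by rewrite pfactor_dvdn. Qed.

Lemma level_periodic c r l : (level (r + 2 ^ c.+1 * l) == c) = (level r == c).
Proof.
have E n : (level n == c) = (2 ^ c %| n.+1)%N && ~~ (2 ^ c.+1 %| n.+1)%N.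
  by rewrite -!level_ge -ltnNge ltnS eqn_leq andbC.
have d1 : (2 ^ c %| 2 ^ c.+1 * l)%N by rewrite expnS mulnAC dvdn_mull.
by rewrite !E -addSn (dvdn_addl _ d1) (dvdn_addl _ (dvdn_mulr _ (dvdnn _))).
Qed.

Lemma sum_dvdn d N : (0 < d)%N ->
  (\sum_(n < N) (d %| n.+1) = N %/ d)%N.
Proof.
move=> d0; elim: N => [|N IH]; first by rewrite big_ord0 div0n.
by rewrite big_ord_recr /= IH divnS// addnC.
Qed.

(** The indices of level at least [C] have density [2 ^ - C], so finitely many
    levels decide up to a small error. *)
Lemma hasmean_levels V (x : nat -> V) M : (forall n, nrm (x n) <= M) ->
  (forall c, hasmean (fun n => (level n == c)%:R *: x n)) -> hasmean x.
Proof.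
move=> xM H; apply: hasmean_approx => e e0.
have M0 : 0 <= M := le_trans (nrm_ge0 _) (xM 0%N).
have [C _ hC] := near_le_natM M e0.
exists (fun n => \sum_(c < C) (level n == c)%:R *: x n).
  by apply: hasmean_sum => c _; exact: H.
have {}hC : M <= e * (2 ^ C)%:R by apply: hC; rewrite /= ltnW// ltn_expl.
apply: nearW => N.
have E n : nrm (x n - \sum_(c < C) (level n == c)%:R *: x n)
    <= (2 ^ C %| n.+1)%:R * M.
  rewrite -scaler_suml -level_ge; case: (leqP C (level n)) => [Cl|lC].
    rewrite big1 ?scale0r ?subr0 ?mul1r// => c _.
    by case: eqP => // lc; have := ltn_ord c; rewrite -lc ltnNge Cl.
  rewrite (bigD1 (Ordinal lC))//= eqxx big1 ?addr0 ?scale1r ?subrr ?nrm0 ?mul0r//.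
  by move=> c /negP nc; case: eqP => // lc; case: nc; apply/eqP/val_inj.
apply: (@le_trans _ _ (\sum_(n < N) (2 ^ C %| n.+1)%:R * M)).
  by apply: ler_sum => n _; exact: E.
rewrite -mulr_suml -natr_sum sum_dvdn ?expn_gt0//.
apply: (@le_trans _ _ ((N %/ 2 ^ C)%:R * (e * (2 ^ C)%:R))).
  by rewrite ler_wpM2l.
by rewrite mulrCA -natrM ler_pM2l// ler_nat leq_divM.
Qed.

Lemma mean0_level V (x : nat -> V) M c : (forall n, nrm (x n) <= M) ->
  (forall r, mean_to (fun l => x (r + 2 ^ c.+1 * l)%N) 0) ->
  mean_to (fun n => (level n == c)%:R *: x n) 0.
Proof.
move=> xM H; apply: (@mean0_residues _ _ _ M (2 ^ c.+1)); first by rewrite expn_gt0.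
  move=> n; apply: le_trans (xM n); rewrite nrmZ normr_nat.
  by case: eqP => _; rewrite ?mul1r ?mul0r ?nrm_ge0.
move=> r _; rewrite -(scaler0 V (level r == c)%:R).
by apply: mean_to_ext (mean_toZ _ (H r)) => l; rewrite level_periodic.
Qed.

Lemma hasmean_level V (x : nat -> V) M c : (forall n, nrm (x n) <= M) ->
  (forall r, hasmean (fun l => x (r + 2 ^ c.+1 * l)%N)) ->
  hasmean (fun n => (level n == c)%:R *: x n).
Proof.
move=> xM H; apply: (@hasmean_residues _ _ _ M (2 ^ c.+1)); first by rewrite expn_gt0.
  move=> n; apply: le_trans (xM n); rewrite nrmZ normr_nat.
  by case: eqP => _; rewrite ?mul1r ?mul0r ?nrm_ge0.
move=> r _.
by apply: hasmean_ext (hasmeanZ _ (H r)) => l; rewrite level_periodic.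
Qed.

End Blocks.

(** * An angle of infinite order *)

Section Angle.
Context (R : realType).

Definition angle : R := acos (3 / 5).

Lemma cos_angle : cos angle = 3 / 5.
Proof. by rewrite acosK// in_itv/=; apply/andP; split; lra. Qed.

(** [5 ^ m * cos (m * angle)] is an integer congruent to [3] modulo [5] for
    [0 < m], by the three-term recurrence of Chebyshev polynomials; hence
    the rotation by [angle] has infinite order. *)
Lemma cos_angleMn_neq1 m : (0 < m)%N -> cos (angle *+ m) != 1.
Proof.
case: m => // m _.
have [x [y [_ hy]]] : exists x y : int, 5 ^+ m * cos (angle *+ m) = x%:~R /\
    5 ^+ m.+1 * cos (angle *+ m.+1) = (3 + 5 * y)%:~R.
  elim: m => [|m [x [y [hx hy]]]].
    exists 1, 0; split; first by rewrite mulr0n cos0 mulr1.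
    by rewrite mulr1n cos_angle expr1 !rmorphE/=; field.
  exists (3 + 5 * y), (3 + 6 * y - 5 * x); split=> //.
  have -> : (3 + 5 * (3 + 6 * y - 5 * x))%:~R
      = 6 * (3 + 5 * y)%:~R - 25 * x%:~R :> R by rewrite !rmorphE/=; ring.
  rewrite -hx -hy; have := cosM_cosMn angle m; rewrite cos_angle !exprS => h.
  have -> : cos (angle *+ m.+2) = 6 / 5 * cos (angle *+ m.+1) - cos (angle *+ m).
    lra.
  by field.
apply/eqP => c1; move: hy; rewrite c1 mulr1 => hy.
have : (5 : int) ^+ m.+1 = 3 + 5 * y by apply: (@intr_inj R); rewrite -hy rmorphXn.
by rewrite exprS; lia.
Qed.

Definition ang (n c : nat) : R := angle *+ (n.*2.+2 ^ c).

Lemma free_phase_ang c : free_phase c (ang^~ c).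
Proof.
exists (angle *+ (2 ^ c * c`!)).
  by move=> m m0; rewrite -mulrnA cos_angleMn_neq1// !muln_gt0 expn_gt0 fact_gt0.
have := is_poly_scale angle (is_poly_linear_power (2 : R) 2 c).
have -> : angle * (2 ^+ c *+ c`!) = angle *+ (2 ^ c * c`!).
  by rewrite mulrnAr mulrnA -natrX mulr_natr.
apply: is_poly_ext => n; rewrite /ang -[RHS]mulr_natr natrX; congr (_ * _ ^+ _).
by rewrite -(mulr_natr 2 n) -natrM -natrD; congr (_%:R); lia.
Qed.

Lemma integer_poly_power g j : integer_poly g (fun n => ((n.*2 + j) ^ g)%N%:Z).
Proof.
have E n : ((n.*2 + j) ^ g)%N%:Z = ((2 : int) *+ n + j%:Z) ^+ g.
  by rewrite -(mulr_natr 2 n) !natz -PoszM -PoszD -[LHS]natz natrX natz;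
    congr (_%:Z ^+ _); lia.
split.
  exists (2 ^ g * g`!)%N; first by rewrite muln_gt0 expn_gt0 fact_gt0.
  have := is_poly_linear_power (2 : int) j%:Z g.
  have -> : (2 : int) ^+ g *+ g`! = (2 ^ g * g`!)%N%:Z.
    by rewrite -natz natrM natrX mulr_natr.
  by apply: is_poly_ext => n; rewrite E.
move=> r m l; rewrite !E.
set p := (_ + _ : int); set q := (_ + _ : int).
exists (l%:Z * 2 * \sum_(i < g) p ^+ (g.-1 - i) * q ^+ i).
apply/eqP; rewrite addrC -subr_eq; apply/eqP; rewrite subrXX.
rewrite mulrA; congr (_ * _).
  by rewrite /p /q -!(mulr_natr 2) natrD natrM !natz; ring.
Qed.

End Angle.

(** * The sequence *)

Section Construction.
Context (R : realType) (B : set nat).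
Hypothesis B_pos : forall b, B b -> (0 < b)%N.

(** On a level [c] of [B] the odd value is taken where
    [alt n * sgn (cos (ang n c)) = 1], see [pick_oddE]. *)
Definition pick_odd (n : nat) : bool :=
  `[< B (level n) >] &&
    (odd (trunc_log 2 n) (+) (0 <= cos (ang R n (level n)))).

Definition bad_seq (m : nat) : nat := (m.*2 + pick_odd m.-1)%N.

Lemma bad_seqS n : bad_seq n.+1 = (n.*2.+2 + pick_odd n)%N.
Proof. by rewrite /bad_seq doubleS. Qed.

Lemma bad_seq_gt0 n : (1 <= n)%N -> (0 < bad_seq n)%N.
Proof. by case: n => // n _; rewrite bad_seqS. Qed.

Lemma bad_seq_increasing m n : (m < n)%N -> (bad_seq m < bad_seq n)%N.
Proof.
by move=> mn; rewrite /bad_seq; case: (pick_odd _); case: (pick_odd _); lia.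
Qed.

Lemma pick_oddE n c : level n = c -> B c ->
  (pick_odd n)%:R = 2^-1 + 2^-1 * (alt R n * sgn (cos (ang R n c))) :> R.
Proof.
move=> lc Bc; rewrite /pick_odd lc asboolT// /alt /sgn -signr_odd /=.
by case: (odd _); case: (0 <= _); rewrite /= ?expr0 ?expr1; lra.
Qed.

Lemma pick_odd_notin n : ~ B (level n) -> pick_odd n = false.
Proof. by move=> nB; rewrite /pick_odd asboolF. Qed.

Section Good.
Context (V : preHilbert R) (cV : complete V) (U : isometric_action int V).
Variables (g : nat) (g0 : (0 < g)%N) (f : V).

(** The contribution of a level [c] of [B] to the averages along the powers [g]
    disappears since its phase has degree [c] and the exponent is [g]. *)
Lemma mean0_alt_sgn c u : (0 < c)%N -> c != g -> integer_poly g u ->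
  mean_to (fun n => alt R n *: ((level n == c)%:R *:
    (sgn (cos (ang R n c)) *: U (u n) f))) 0.
Proof.
move=> c0 cg iu; apply: mean0_alt; apply: (@mean0_level _ _ _ (nrm f)).
  move=> n; rewrite nrmZ nrm_act /sgn.
  by case: ifP => _; rewrite ?normrN normr1 mul1r.
move=> r; have q0 : (0 < 2 ^ c.+1)%N by rewrite expn_gt0.
have fp := free_phase_dilate r q0 (free_phase_ang R c).
have ip := integer_poly_dilate r q0 iu.
apply: (mean0_sgn c0 fp (M := nrm f)) => [n|k k0]; first by rewrite nrm_act.
exact: mean0_twisted (free_phaseMn k0 fp) ip.
Qed.

Lemma hasmean_level_action c u : integer_poly g u ->
  hasmean (fun n => (level n == c)%:R *: U (u n) f).
Proof.
move=> iu; apply: (@hasmean_level _ _ _ (nrm f)) => [n|r].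
  by rewrite nrm_act.
apply: (hasmean_integer_poly cV _ _ g0).
by apply: integer_poly_dilate => //; rewrite expn_gt0.
Qed.

Lemma hasmean_bad_seq : ~ B g ->
  hasmean (fun n => U (bad_seq n.+1 ^ g)%N%:Z f).
Proof.
move=> Bg.
pose u0 n := ((n.*2 + 2) ^ g)%N%:Z; pose u1 n := ((n.*2 + 3) ^ g)%N%:Z.
have i0 : integer_poly g u0 by exact: integer_poly_power.
have i1 : integer_poly g u1 by exact: integer_poly_power.
apply: (@hasmean_levels _ _ _ (nrm f)) => [n|c]; first by rewrite nrm_act.
have [Bc|nBc] := pselect (B c); last first.
  apply: hasmean_ext (hasmean_level_action c i0) => n.
  case: eqP => [lc|]; rewrite ?scale0r// bad_seqS pick_odd_notin ?lc//.
  by rewrite addn0 -addn2.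
have c0 : (0 < c)%N by exact: B_pos.
have cg : c != g by apply/eqP => cg; rewrite cg in Bc.
have := hasmeanD
  (hasmeanZ 2^-1 (hasmeanD (hasmean_level_action c i0) (hasmean_level_action c i1)))
  (hasmeanZ 2^-1 (hasmeanB (mean_to_hasmean (mean0_alt_sgn c0 cg i1))
     (mean_to_hasmean (mean0_alt_sgn c0 cg i0)))).
apply: hasmean_ext => n; case: eqP => [lc|]; last first.
  by rewrite !(scale0r, scaler0, subr0, addr0).
rewrite !scale1r bad_seqS.
have two : 2 != 0 :> R by [].
have := pick_oddE lc Bc; case: pick_odd => /= E.
- have {}E : alt R n * sgn (cos (ang R n c)) = 1 by lra.
  rewrite !scalerA E !scale1r -scalerDr addrC addrA subrK -mulr2n.
  by rewrite -(scaler_nat 2 (U _ _)) scalerA mulVf// scale1r addn1 -addn3.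
- have {}E : alt R n * sgn (cos (ang R n c)) = -1 by lra.
  rewrite !scalerA E !scaleN1r -scalerDr opprK addrA addrK -mulr2n.
  by rewrite -(scaler_nat 2 (U _ _)) scalerA mulVf// scale1r addn0 -addn2.
Qed.

End Good.

Section Bad.

(** The sum and the difference of the phases have the larger of the two degrees
    and, up to sign, the top coefficient of the phase of that degree. *)
Lemma mean0_cos_cos c d (phi psi : nat -> R) : (0 < c)%N -> (0 < d)%N ->
  c != d -> free_phase c phi -> free_phase d psi ->
  mean_to (V := realH R) (fun n => cos (phi n) * cos (psi n)) 0.
Proof.
move=> c0 d0; wlog cd : c d phi psi c0 d0 / (c < d)%N.
  move=> W cd fc fd; move: (cd); rewrite neq_ltn => /orP[h|h]; first exact: (W c d).
  by apply: mean_to_ext (W d c psi phi d0 c0 h _ fd fc) => [n|]; rewrite 1?mulrC// eq_sym.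
move=> _ [s _ hs] [t ht hpsi].
have fp : free_phase d (fun n => psi n + phi n).
  by exists t => //; have := is_polyD hpsi (is_poly_weaken cd hs); rewrite addr0.
have fm : free_phase d (fun n => psi n - phi n).
  exists t => //.
  have := is_polyD hpsi (is_poly_scale (-1) (is_poly_weaken cd hs)).
  by rewrite mulr0 addr0; apply: is_poly_ext => n; rewrite mulN1r.
have h1 := mean0_free_phase (2^-1 : realH R) d0 fp.
have h2 := mean0_free_phase (2^-1 : realH R) d0 fm.
have := mean_toD h1 h2; rewrite addr0; apply: mean_to_ext => n.
change (cos (psi n + phi n) * 2^-1 + cos (psi n - phi n) * 2^-1
  = cos (phi n) * cos (psi n)).
by rewrite cosB cosD; field.
Qed.

Lemma mean_level c : exists2 m : R, 0 < m &
  mean_to (V := realH R) (fun n => (level n == c)%:R) m.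
Proof.
pose q := (2 ^ c.+1)%N.
exists (q%:R^-1 * \sum_(r < q) (level r == c)%:R).
  rewrite mulr_gt0 ?invr_gt0 ?ltr0n ?expn_gt0//.
  have rq : ((2 ^ c).-1 < q)%N.
    by rewrite prednK ?expn_gt0// leq_exp2l.
  rewrite (bigD1 (Ordinal rq))//= ltr_pwDl//; last exact: sumr_ge0.
  by rewrite /level prednK ?expn_gt0// pfactorK// eqxx.
move=> e e0; apply: (@mean_within_residues _ (realH R) _ 1 q
    (fun r => (level r == c)%:R : R) 0 e) => //.
- by rewrite expn_gt0.
- by move=> n; rewrite nrm_realH normr_nat; case: (_ == _).
- move=> r _; apply: nearW => L.
  under eq_bigr => l _ do rewrite /q level_periodic.
  by rewrite sumr_const card_ord scaler_nat subrr nrm0 mul0r.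
Qed.

(** Half the sum of [cos (angle *+ k)] and [cos ((angle + pi) *+ k)] is the former
    for even [k] and [0] for odd [k]; so its average only sees the indices [n]
    with [pick_odd n = false], which on the level [b] and on every block of
    [alt] are biased towards one sign of the cosine. The other levels have a
    limit since their phases have other degrees. *)
Lemma bad_seq_not_hasmean b : (0 < b)%N -> B b ->
  hasmean (V := realH R) (fun n => cos (angle R *+ (bad_seq n.+1 ^ b))) ->
  hasmean (V := realH R) (fun n => cos ((angle R + pi) *+ (bad_seq n.+1 ^ b))) ->
  False.
Proof.
move=> b0 Bb h1 h2.
pose C n := cos (ang R n b).
have fb := free_phase_ang R b.
have q0 c : (0 < 2 ^ c.+1)%N by rewrite expn_gt0.
have C1 n : nrm (C n : realH R) <= 1 by rewrite nrm_realH ler_norml cos_geN1 cos_le1.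
have s1 y : `|sgn y| = 1 :> R by rewrite /sgn; case: ifP => _; rewrite ?normrN normr1.
have hE : hasmean (V := realH R) (fun n => (1 - (pick_odd n)%:R) * C n).
  have := hasmeanD (hasmeanZ (2^-1 : R) h1) (hasmeanZ (2^-1 : R) h2).
  apply: hasmean_ext => n.
  set k := (bad_seq n.+1 ^ b)%N.
  have sgnpi (m : nat) x : cos (x + pi *+ m) = (-1) ^+ m * cos x.
    elim: m => [|m IH]; first by rewrite mulr0n addr0 expr0 mul1r.
    by rewrite mulrSr addrA cosDpi IH exprS mulN1r mulNr.
  change (2^-1 * cos (angle R *+ k) + 2^-1 * cos ((angle R + pi) *+ k)
    = (1 - (pick_odd n)%:R) * C n).
  rewrite mulrnDl sgnpi -signr_odd.
  have ok : odd k = pick_odd n.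
    by rewrite /k bad_seqS oddX eqn0Ngt b0 oddD /= odd_double; case: pick_odd.
  rewrite ok; case: (boolP (pick_odd n)) ok => p ok.
    by rewrite expr1 subrr mul0r mulN1r mulrN subrr.
  by rewrite expr0 /C /ang /k bad_seqS (negbTE p) addn0 subr0; field.
have C0 : mean_to (V := realH R) C 0.
  by apply: mean_to_ext (mean0_free_phase (1 : realH R) b0 fb) => n; exact: mulr1.
pose w n := (pick_odd n)%:R * C n.
have w1 n : nrm (w n : realH R) <= 1.
  rewrite nrm_realH normrM normr_nat; have := C1 n; rewrite nrm_realH.
  by case: pick_odd; rewrite ?mul1r ?mul0r.
have hw : hasmean (V := realH R) w.
  apply: hasmean_ext (hasmeanB (mean_to_hasmean C0) hE) => n.
  by rewrite /w mulrBl mul1r opprB addrC subrK.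
have levC c : mean_to (V := realH R) (fun n => (level n == c)%:R * C n) 0.
  apply: (@mean0_level _ (realH R) C 1) => // r.
  have := mean0_free_phase (1 : realH R) b0 (free_phase_dilate r (q0 c) fb).
  by apply: mean_to_ext => n; exact: mulr1.
have wE n c : level n = c -> B c ->
    w n = 2^-1 * C n + 2^-1 * (alt R n * (sgn (cos (ang R n c)) * C n)).
  by move=> lc Bc; rewrite /w (pick_oddE lc Bc); ring.
have hw' : hasmean (V := realH R) (fun n => (level n != b)%:R * w n).
  apply: (@hasmean_levels _ (realH R) _ 1) => [n|c].
    rewrite nrm_realH normrM normr_nat; have := w1 n; rewrite nrm_realH.
    by case: (_ != _); rewrite ?mul1r ?mul0r.
  have [cb|cb] := eqVneq c b.
    apply: hasmean_ext (mean_to_hasmean (mean_to_cst (0 : realH R))) => n.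
    rewrite cb; case: (_ == _) => /=; first by rewrite mul0r scaler0.
    by rewrite scale0r.
  have [Bc|nBc] := pselect (B c); last first.
    apply: hasmean_ext (mean_to_hasmean (mean_to_cst (0 : realH R))) => n.
    case: eqP => [lc|]; last by rewrite scale0r.
    by rewrite /w pick_odd_notin ?lc// mul0r mulr0 scaler0.
  have cb' : (0 < c)%N by exact: B_pos.
  have hc := @mean0_level _ (realH R) (fun n => sgn (cos (ang R n c)) * C n) 1 c.
  have {}hc : mean_to (V := realH R)
      (fun n => (level n == c)%:R * (sgn (cos (ang R n c)) * C n)) 0.
    apply: hc => [n|r].
      by rewrite nrm_realH normrM s1 mul1r; have := C1 n; rewrite nrm_realH.
    have fpc := free_phase_dilate r (q0 c) (free_phase_ang R c).
    have fpb := free_phase_dilate r (q0 c) fb.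
    apply: (@mean0_sgn _ (realH R) c _ (fun l => C (r + 2 ^ c.+1 * l)%N) 1 cb' fpc)
      => [n|k k0].
      exact: C1.
    exact: mean0_cos_cos cb' b0 cb (free_phaseMn k0 fpc) fpb.
  have {}hc := mean0_alt hc.
  have := mean_toD (mean_toZ (2^-1 : R) (levC c)) (mean_toZ (2^-1 : R) hc).
  move=> /mean_to_hasmean; apply: hasmean_ext => n.
  change (2^-1 * ((level n == c)%:R * C n)
     + 2^-1 * (alt R n * ((level n == c)%:R * (sgn (cos (ang R n c)) * C n)))
     = (level n == c)%:R * ((level n != b)%:R * w n)).
  case: eqP => [lc|_]; last by rewrite /= !(mul0r, mulr0) addr0.
  by rewrite lc cb /= !mul1r (wE n c lc Bc).
pose y n := (level n == b)%:R * `|C n|.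
have hy : hasmean (V := realH R) (fun n => alt R n * y n).
  have := hasmeanB (hasmeanB hw hw') (hasmeanZ (2^-1 : R) (mean_to_hasmean (levC b))).
  move=> /(hasmeanZ (2 : R)); apply: hasmean_ext => n.
  change (2 * (w n - (level n != b)%:R * w n - 2^-1 * ((level n == b)%:R * C n))
    = alt R n * y n).
  rewrite /y; case: eqP => [lb|_]; last by rewrite /= !mul1r !mul0r !mulr0; lra.
  rewrite (wE n b lb Bb) -/(C n).
  have -> : `|C n| = sgn (C n) * C n.
    by rewrite /sgn; case: (leP 0 (C n)) => [/ger0_norm ->|/ltr0_norm ->];
      rewrite ?mul1r ?mulN1r.
  by rewrite /= mul0r mul1r; field.
have [m m0 hm] := mean_level b.
have m2 : 0 < 2^-1 * m by rewrite mulr_gt0.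
apply: (@alt_not_hasmean _ y (fun n => (level n == b)%:R * C n ^+ 2) (2^-1 * m)) => //.
  move=> n; rewrite /y ler_wpM2l// -real_normK ?num_real//.
  rewrite expr2 ler_piMl//; have := C1 n; by rewrite nrm_realH.
have hcos : mean_to (V := realH R)
    (fun n => (level n == b)%:R * cos (ang R n b *+ 2)) 0.
  apply: (@mean0_level _ (realH R) (fun n => cos (ang R n b *+ 2)) 1).
    by move=> n; rewrite nrm_realH ler_norml cos_geN1 cos_le1.
  move=> r; have fp := free_phaseMn (isT : 0 < 2)%N (free_phase_dilate r (q0 b) fb).
  have := mean0_free_phase (1 : realH R) b0 fp.
  by apply: mean_to_ext => n; exact: mulr1.
have := mean_toD (mean_toZ (2^-1 : R) hm) (mean_toZ (2^-1 : R) hcos).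
rewrite scaler0 addr0; apply: mean_to_ext => n.
change (2^-1 * (level n == b)%:R + 2^-1 * ((level n == b)%:R * cos (ang R n b *+ 2))
  = (level n == b)%:R * C n ^+ 2).
by rewrite /C mulr2n cosD -!expr2 sin2cos2; field.
Qed.

End Bad.
End Construction.

(** * The space of square integrable functions *)

Section SquareIntegrable.
Context (R : realType) (d : measure_display) (X : measurableType d).
Variable mu : probability X R.

Lemma one_le_two : (1 <= 2%:E :> \bar R)%E.
Proof. by rewrite lee_fin ler1n. Qed.

Local Notation L2 := (LfunType mu one_le_two).

Lemma L2_in (f : L2) : (f : X -> R) \in Lfun mu 2%:E.
Proof. exact: (LfunP f). Qed.

Lemma L2_measurable (f : L2) : measurable_fun setT f.
Proof. exact: measurable_funPT. Qed.

Lemma L2_integrableM (f g : L2) : mu.-integrable setT (EFin \o (fun x => f x * g x)).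
Proof. by apply/Lfun1_integrable; exact: Lfun2_mul_Lfun1 (L2_in f) (L2_in g). Qed.

Definition L2_dot (f g : L2) : R := \int[mu]_x (f x * g x).

Definition L2H : preHilbert R.
Proof.
apply: (@PreHilbert R L2 L2_dot) => [f g|f g h|a f g|f]; rewrite /L2_dot.
- by apply: eq_Rintegral => x _; rewrite mulrC.
- rewrite -RintegralD//; try exact: L2_integrableM.
  by apply: eq_Rintegral => x _; rewrite -mulrDl.
- rewrite -RintegralZl//; last exact: L2_integrableM.
  by apply: eq_Rintegral => x _; rewrite mulrA.
- by apply: Rintegral_ge0 => x _; rewrite -expr2 sqr_ge0.
Defined.

Lemma EFin_L2_dot (f g : L2H) : (dot f g)%:E = (\int[mu]_x (f x * g x)%:E)%E.
Proof.
by rewrite fineK//; apply: integrable_fin_num => //; exact: L2_integrableM.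
Qed.

Lemma L2_nrm_sqr (f : L2H) :
  ((nrm f ^+ 2)%:E = \int[mu]_x (f x ^+ 2)%:E)%E.
Proof. by rewrite nrm_sqr EFin_L2_dot. Qed.

Lemma in_L2 (f : X -> R) : measurable_fun setT f ->
  (\int[mu]_x (f x ^+ 2)%:E < +oo)%E -> f \in Lfun mu 2%:E.
Proof.
move=> mf fi; rewrite inE; apply/andP; split; rewrite inE//=.
rewrite /finite_norm unlock; apply: poweR_lty.
rewrite (eq_integral (fun x => (f x ^+ 2)%:E))// => x _ /=.
rewrite powR_mulrn// real_normK ?num_real//.
Qed.

Definition toL2 (f : X -> R) (hf : f \in Lfun mu 2%:E) : L2H :=
  Lfun_Sub one_le_two hf.

Lemma toL2E (f : X -> R) (hf : f \in Lfun mu 2%:E) : (toL2 hf : X -> R) = f.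
Proof. exact: Lfun_valP. Qed.

Lemma L1_le_L2 (f : L2H) : (\int[mu]_x `|f x|%:E <= (nrm f)%:E)%E.
Proof.
have mf := L2_measurable f.
have ha : (fun x => `|f x|) \in Lfun mu 2%:E.
  apply: in_L2; first exact: measurableT_comp.
  rewrite (eq_integral (fun x => (f x ^+ 2)%:E)) => [|x _].
    by rewrite -L2_nrm_sqr ltry.
  by rewrite real_normK ?num_real.
have h1 : cst 1 \in Lfun mu 2%:E by exact: Lfun_cst.
have := dot_le (toL2 ha) (toL2 h1).
have -> : nrm (toL2 ha) = nrm f.
  congr Num.sqrt; apply: eq_Rintegral => x _.
  by rewrite !toL2E -!expr2 real_normK ?num_real.
have -> : nrm (toL2 h1) = 1.
  rewrite /nrm /= /L2_dot; under eq_Rintegral do rewrite !toL2E mulr1.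
  rewrite Rintegral_cst//= probability_setT/= mulr1; exact: sqrtr1.
rewrite mulr1 -lee_fin EFin_L2_dot.
by under eq_integral do rewrite !toL2E mulr1.
Qed.

Lemma limn_einf_le (v : (\bar R)^nat) c :
  (\forall n \near \oo, (v n <= c)%E) -> (limn_einf v <= c)%E.
Proof.
move=> h; rewrite limn_einf_lim; apply: lime_le; first exact: is_cvg_einfs.
near=> n; apply: (@le_trans _ _ (v n)); last by near: n.
by apply: ereal_inf_lbound; exists n => /=.
Unshelve. all: by end_near. Qed.

Let rate (k : nat) : R := 1 / (2 ^ (k + 1))%:R.

Let rate_gt0 k : 0 < rate k.
Proof. by rewrite divr_gt0// ltr0n expn_gt0. Qed.

Lemma fast_subsequence (x : nat -> L2H) : cauchy_seq x ->
  exists phi : nat -> nat, (forall k, (phi k <= phi k.+1)%N) /\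
    forall k m, (phi k <= m)%N -> nrm (x m - x (phi k)) <= rate k.
Proof.
move=> hx; have /choice[N hN] k : exists n0, forall m n, (n0 <= m)%N ->
    (n0 <= n)%N -> nrm (x m - x n) <= rate k.
  have r2 : 0 < rate k / 2 by rewrite divr_gt0.
  have [y [n0 _ hn0]] := hx _ r2; exists n0 => m n nm nn.
  apply: le_trans (nrm_triangle y _ _) _; rewrite (nrmBC y).
  by rewrite [leRHS]splitr lerD//; exact: hn0.
exists (fun k => \max_(i < k.+1) N i)%N; split=> [k|k m].
  by rewrite [in leqRHS]big_ord_recr leq_maxl.
have Nk : (N k <= \max_(i < k.+1) N i)%N by exact: (leq_bigmax (ord_max : 'I_k.+1)).
by move=> km; apply: hN => //; exact: leq_trans km.
Qed.

(** Riesz and Fischer. Along a fast subsequence the increments are summable in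
    [L1], hence almost everywhere; the almost everywhere limit is the limit in
    [L2] by Fatou's lemma. *)
Theorem L2_complete : complete L2H.
Proof.
move=> x hx; have [phi [phiS hphi]] := fast_subsequence hx.
have phi_le j k : (j <= k)%N -> (phi j <= phi k)%N.
  by elim: k => [|k IH]; rewrite leq_eqVlt => /predU1P[->//|//]; rewrite ltnS
    => /IH /leq_trans; apply.
pose u k : L2H := x (phi k).
have uM k : measurable_fun setT (u k) by exact: L2_measurable.
have ud j k : (k <= j)%N -> nrm (u j - u k) <= rate k.
  by move=> kj; apply: hphi; exact: phi_le.
pose D k t := `|u k.+1 t - u k t|.
have mD k : measurable_fun setT (D k).
  by apply: measurableT_comp => //; exact: measurable_funB.
pose h t := (\sum_(0 <= k <oo) (D k t)%:E)%E.
have h_int : (\int[mu]_t h t < +oo)%E.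
  rewrite integral_nneseries//; last 2 first.
  - by move=> k; apply/measurable_EFinP.
  - by move=> k t _; rewrite lee_fin normr_ge0.
  apply: (@le_lt_trans _ _ (\sum_(0 <= k <oo) (rate k)%:E)%E); last first.
    have /cvg_lim := @cvg_geometric_eseries_half R 1 0.
    by rewrite /eseries /rate => ->//; exact: ltry.
  apply: lee_nneseries => [k _ _|k _].
    by apply: integral_ge0 => t _; rewrite lee_fin normr_ge0.
  apply: (@le_trans _ _ (nrm (u k.+1 - u k))%:E); last by rewrite lee_fin ud.
  apply: le_trans (L1_le_L2 (u k.+1 - u k)).
  by rewrite le_eqVlt; apply/orP; left; apply/eqP; apply: eq_integral.
have h_ge0 t : (0 <= h t)%E by apply: nneseries_ge0 => k _ _; rewrite lee_fin normr_ge0.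
have mh : measurable_fun setT h.
  by apply: ge0_emeasurable_sum => [k t _ _|k _];
    [rewrite lee_fin normr_ge0|exact/measurable_EFinP].
pose E := [set t | (h t < +oo)%E].
have mE : measurable E.
  by rewrite -[E]setTI; exact: emeasurable_fun_infty_o.
have aeE : {ae mu, forall t, E t}.
  have : mu.-integrable setT h.
    apply/integrableP; split=> //.
    by under eq_integral => t _ do rewrite gee0_abs//.
  move=> /(integrable_ae measurableT); apply: filterS => t /(_ I).
  by rewrite /E /= ge0_fin_numE.
have cvgE t : E t -> cvgn (fun k => u k t).
  move=> Et; have : cvgn (series (fun k => u k.+1 t - u k t)).
    by apply: normed_cvg; apply: nnseries_is_cvg => // k; exact: normr_ge0.
  move=> /cvg_ex[l hl]; apply/cvg_ex; exists (l + u 0%N t).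
  have -> : (fun k => u k t) = (fun k => series (fun k => u k.+1 t - u k t) k + u 0%N t).
    by apply/funext => k; rewrite /series/= telescope_sumr// subrK.
  by apply: cvgD => //; exact: cvg_cst.
pose v k t := u k t * \1_E t.
pose g t := limn (fun k => v k t).
have cvgv t : (fun k => v k t) @ \oo --> g t.
  have [Et|nEt] := pselect (E t).
    have vE : (fun k => v k t) = (fun k => u k t).
      by apply/funext => k; rewrite /v indicE mem_set// mulr1.
    by rewrite /g vE; exact: cvgE.
  have vE : (fun k => v k t) = (fun=> 0).
    by apply/funext => k; rewrite /v indicE memNset// mulr0.
  by rewrite /g vE; exact: is_cvg_cst.
have mg : measurable_fun setT g.
  apply: (@measurable_fun_cvg _ _ _ _ v) => [k|t _].
    by apply: measurable_funM => //; exact: measurable_indic.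
  exact: cvgv.
have gu k : (\int[mu]_t ((g t - u k t) ^+ 2)%:E <= (rate k ^+ 2)%:E)%E.
  pose F j t := ((u j t - u k t) ^+ 2)%:E.
  have mF j : measurable_fun setT (F j).
    by apply/measurable_EFinP; apply: measurable_funX; exact: measurable_funB.
  have F0 j t : setT t -> (0 <= F j t)%E by move=> _; rewrite lee_fin sqr_ge0.
  have := fatou mu measurableT mF F0.
  have <- : (\int[mu]_t ((g t - u k t) ^+ 2)%:E = \int[mu]_t limn_einf (F^~ t))%E.
    apply: ge0_ae_eq_integral => //.
    - by apply/measurable_EFinP; apply: measurable_funX; exact: measurable_funB.
    - apply: (emeasurable_fun_cvg (fun n t => einfs (F^~ t) n)) => [n|t _].
        exact: measurable_fun_einfs.
      by rewrite limn_einf_lim; exact: is_cvg_einfs.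
    - by move=> t _; rewrite lee_fin sqr_ge0.
    - move=> t _; rewrite limn_einf_lim; apply: lime_ge; first exact: is_cvg_einfs.
      by apply: nearW => n; apply: le_ereal_inf_tmp => _ [m _ <-]; exact: F0.
    move: aeE; apply: filterS => t Et _.
    have := cvgv t; have -> : v^~ t = (fun j => u j t).
      by apply/funext => j; rewrite /v indicE mem_set// mulr1.
    move=> hc; have : F^~ t @ \oo --> ((g t - u k t) ^+ 2)%:E.
      apply: cvg_EFin; first by near=> j.
      have hs : (fun j => u j t - u k t) @ \oo --> g t - u k t.
        by apply: cvgB => //; exact: cvg_cst.
      by rewrite expr2; apply: cvg_trans (cvgM hs hs).
    by move=> /cvg_limn_einf_sup[-> _].
  move=> /le_trans; apply; apply: limn_einf_le; near=> j.
  have kj : (k <= j)%N by near: j; exact: nbhs_infty_ge.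
  rewrite -(L2_nrm_sqr (u j - u k)) lee_fin.
  by rewrite ler_sqr ?nnegrE ?nrm_ge0 ?(ltW (rate_gt0 k))//; exact: ud.
have gk k : (fun t => g t - u k t) \in Lfun mu 2%:E.
  apply: in_L2; first exact: measurable_funB.
  by apply: le_lt_trans (gu k) _; exact: ltry.
pose y : L2H := toL2 (gk 0%N) + u 0%N.
have yE t : y t = g t.
  have -> : y t = toL2 (gk 0%N) t + u 0%N t by [].
  by rewrite toL2E subrK.
have yu k : nrm (y - u k) <= rate k.
  rewrite -ler_sqr ?nnegrE ?nrm_ge0 ?(ltW (rate_gt0 k))// -lee_fin L2_nrm_sqr.
  apply: le_trans (gu k); rewrite le_eqVlt; apply/orP; left; apply/eqP.
  by apply: eq_integral => t _; rewrite -yE.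
exists y => e e0.
have [k hk] : exists k, rate k <= e / 2.
  have e2 : 0 < e / 2 by rewrite divr_gt0.
  have [n0 _ hn0] := near_le_natM 1 e2.
  exists n0; rewrite /rate ler_pdivrMr ?ltr0n ?expn_gt0//; apply: hn0 => /=.
  by rewrite addn1 ltnW// ltnW// ltn_expl.
exists (phi k) => // n /= hn; apply: le_trans (nrm_triangle (u k) _ _) _.
rewrite [leRHS]splitr lerD//; last by rewrite nrmBC; exact: le_trans (yu k) hk.
exact: le_trans (hphi k n hn) hk.
Unshelve. all: by end_near. Qed.

End SquareIntegrable.

(** * The Koopman action *)

Section Koopman.
Context (R : realType) (d : measure_display) (X : measurableType d).
Variables (mu : probability X R) (T Tinv : X -> X).
Hypothesis Tmp : invertible_measure_preserving mu T Tinv.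

Let TK : cancel T Tinv. Proof. by case: Tmp. Qed.
Let TinvK : cancel Tinv T. Proof. by case: Tmp. Qed.

Let iterz1 k x : iterz T Tinv (k + 1) x = T (iterz T Tinv k x).
Proof.
case: k => [n|[|n]].
- by rewrite -PoszD addn1.
- by rewrite (_ : Negz 0 + 1 = 0)//= TinvK.
- by rewrite (_ : Negz n.+1 + 1 = Negz n)/=; [rewrite TinvK|rewrite !NegzE; lia].
Qed.

Lemma iterzD g h x :
  iterz T Tinv (g + h) x = iterz T Tinv h (iterz T Tinv g x).
Proof.
case: h => n.
  elim: n => [|n IH]; first by rewrite addr0.
  by rewrite intS [1 + _]addrC addrA iterz1 IH -iterz1.
elim: n => [|n IH].
  by rewrite -[LHS]TK -iterz1 (_ : g + Negz 0 + 1 = g)//; lia.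
rewrite -[LHS]TK -iterz1 (_ : g + Negz n.+1 + 1 = g + Negz n); first by rewrite IH.
by rewrite !NegzE; lia.
Qed.

Definition measure_preserving (S : X -> X) : Prop :=
  measurable_fun setT S /\ forall A, measurable A -> mu (S @^-1` A) = mu A.

Lemma measure_preserving_iter S n :
  measure_preserving S -> measure_preserving (iter n S).
Proof.
move=> [mS hS]; elim: n => [|n [mI hI]].
  by split=> [|A _]; [exact: measurable_id|].
split; first exact: (measurableT_comp mS mI).
move=> A mA; have mSA : measurable (S @^-1` A) by rewrite -[_ @^-1` _]setTI; exact: mS.
by rewrite -(hS A mA) -(hI _ mSA).
Qed.

Lemma measure_preserving_iterz k : measure_preserving (iterz T Tinv k).
Proof.
have [_ _ mT mTi hT] := Tmp.
case: k => n; apply: measure_preserving_iter; split=> // A mA.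
have mTA : measurable (Tinv @^-1` A) by rewrite -[_ @^-1` _]setTI; exact: mTi.
rewrite -(hT _ mTA); congr (mu _).
by apply/seteqP; split => x /=; rewrite TK.
Qed.

Lemma integral_measure_preserving S (f : X -> \bar R) :
  measure_preserving S -> measurable_fun setT f -> (forall x, 0 <= f x)%E ->
  (\int[mu]_x f (S x) = \int[mu]_x f x)%E.
Proof.
move=> [mS hS] mf f0.
rewrite -[LHS](ge0_integral_pushforward mS mu measurableT mf)//.
by apply: eq_measure_integral => A mA _; exact: hS.
Qed.

Lemma L2_comp S (f : L2H mu) : measure_preserving S ->
  (fun x => f (S x)) \in Lfun mu 2%:E.
Proof.
move=> hS; have mf := L2_measurable f; apply: in_L2.
  by apply: (measurableT_comp mf); case: hS.
rewrite (@integral_measure_preserving S (fun x => (f x ^+ 2)%:E))//.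
- by rewrite -L2_nrm_sqr ltry.
- by apply/measurable_EFinP; exact: measurable_funX.
- by move=> x; rewrite lee_fin sqr_ge0.
Qed.

Let koop k (f : L2H mu) : L2H mu :=
  toL2 (L2_comp f (measure_preserving_iterz k)).

Let koopE k f x : koop k f x = f (iterz T Tinv k x).
Proof. by rewrite /koop toL2E. Qed.

Lemma L2_ext (f g : L2H mu) : (f : X -> R) =1 g -> f = g.
Proof. by move=> fg; apply/LfuneqP. Qed.

Let koop_linear k : linear (koop k).
Proof.
move=> a f g; apply: L2_ext => x.
have -> : (a *: koop k f + koop k g : L2H mu) x = a * koop k f x + koop k g x by [].
by rewrite !koopE.
Qed.

Let koop_nrm k f : nrm (koop k f) = nrm f.
Proof.
apply/eqP; rewrite -(eqrXn2 (isT : 0 < 2)%N) ?nrm_ge0//; apply/eqP.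
apply: EFin_inj; rewrite !L2_nrm_sqr.
under eq_integral do rewrite koopE.
apply: (@integral_measure_preserving _ (fun x => (f x ^+ 2)%:E)).
- exact: measure_preserving_iterz.
- by apply/measurable_EFinP; apply: measurable_funX; exact: L2_measurable.
- by move=> x; rewrite lee_fin sqr_ge0.
Qed.

Definition koopman : isometric_action int (L2H mu).
Proof.
apply: (@IsometricAction _ _ _ koop koop_linear) => [k f g|f|k l f].
- have polar (u v : L2H mu) :
      dot u v = (nrm (u + v) ^+ 2 - nrm u ^+ 2 - nrm v ^+ 2) / 2.
    by rewrite !nrm_sqr dotDl !dotDr (dotC v u); field.
  have kD : koop k (f + g) = koop k f + koop k g.
    by have := koop_linear k 1 f g; rewrite !scale1r.
  by rewrite !polar -kD !koop_nrm.
- by apply: L2_ext => x; rewrite koopE.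
- by apply: L2_ext => x; rewrite !koopE iterzD.
Defined.

Lemma koopmanE k f x : koopman k f x = f (iterz T Tinv k x).
Proof. exact: koopE. Qed.

End Koopman.

(** * Complex ergodic averages as pairs of real ones *)

Section ComplexFunctions.
Context (R : realType) (d : measure_display) (X : measurableType d).
Variables (mu : probability X R).

Lemma L2_sumE (I : Type) (r : seq I) (F : I -> L2H mu) x :
  ((\sum_(i <- r) F i : L2H mu) : X -> R) x = \sum_(i <- r) F i x.
Proof. by elim/big_rec2 : _ => // i _ y _ <-. Qed.

Lemma L2C_norm_pair (h : X -> R[i]) (p q : L2H mu) :
  (forall x, complex.Re (h x) = p x) -> (forall x, complex.Im (h x) = q x) ->
  L2C_norm mu h = (nrm ((p, q) : prodH (L2H mu) (L2H mu)))%:E.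
Proof.
move=> hp hq; rewrite /L2C_norm unlock.
have -> : (\int[mu]_x (`|(ComplexField.Normc.normc (h x))%:E| `^ 2)
    = (nrm ((p, q) : prodH (L2H mu) (L2H mu)) ^+ 2)%:E)%E.
  rewrite nrm_prodH_sqr EFinD !L2_nrm_sqr -ge0_integralD//.
  - apply: eq_integral => x _; rewrite -EFinD /= -hp -hq.
    case: (h x) => u v /=; rewrite ger0_norm ?sqrtr_ge0// powR_mulrn ?sqrtr_ge0//.
    by rewrite sqr_sqrtr// addr_ge0 ?sqr_ge0.
  - by move=> x _; rewrite lee_fin sqr_ge0.
  - by apply/measurable_EFinP; apply: measurable_funX; exact: L2_measurable.
  - by move=> x _; rewrite lee_fin sqr_ge0.
  - by apply/measurable_EFinP; apply: measurable_funX; exact: L2_measurable.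
rewrite poweR_EFin powR12_sqrt ?sqr_ge0// sqrtr_sqr ger0_norm//; exact: nrm_ge0.
Qed.

Variables (T Tinv : X -> X).
Hypothesis Tmp : invertible_measure_preserving mu T Tinv.
Variables (f : X -> R[i]) (hf : L2C mu f) (a : nat -> int).

Let re : L2H mu := toL2 hf.1.
Let im : L2H mu := toL2 hf.2.

Definition orbit_pair (n : nat) : prodH (L2H mu) (L2H mu) :=
  (koopman Tmp (a n.+1) re, koopman Tmp (a n.+1) im).

Let average_Re N x : complex.Re (ergodic_average T Tinv a f N x) =
  (N%:R^-1 *: \sum_(n < N) koopman Tmp (a n.+1) re : L2H mu) x.
Proof.
transitivity (N%:R^-1 * (\sum_(n < N) koopman Tmp (a n.+1) re : L2H mu) x) => //.
rewrite L2_sumE /ergodic_average.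
have -> : N%:R^-1 = (N%:R^-1)%:C%C :> R[i] by rewrite fmorphV rmorph_nat.
rewrite big_add1 big_mkord/=.
have ReD (u v : R[i]) : complex.Re (u + v) = complex.Re u + complex.Re v.
  by case: u v => [? ?] [].
have -> (r : R) (z : R[i]) : complex.Re (r%:C%C * z) = r * complex.Re z.
  by case: z => u v; rewrite /= mul0r subr0.
rewrite (big_morph (fun z => complex.Re z) ReD (erefl : complex.Re (0 : R[i]) = 0)).
by congr (_ * _); apply: eq_bigr => i _; rewrite koopmanE toL2E.
Qed.

Let average_Im N x : complex.Im (ergodic_average T Tinv a f N x) =
  (N%:R^-1 *: \sum_(n < N) koopman Tmp (a n.+1) im : L2H mu) x.
Proof.
transitivity (N%:R^-1 * (\sum_(n < N) koopman Tmp (a n.+1) im : L2H mu) x) => //.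
rewrite L2_sumE /ergodic_average.
have -> : N%:R^-1 = (N%:R^-1)%:C%C :> R[i] by rewrite fmorphV rmorph_nat.
rewrite big_add1 big_mkord/=.
have ImD (u v : R[i]) : complex.Im (u + v) = complex.Im u + complex.Im v.
  by case: u v => [? ?] [].
have -> (r : R) (z : R[i]) : complex.Im (r%:C%C * z) = r * complex.Im z.
  by case: z => u v; rewrite /= mul0r addr0.
rewrite (big_morph (fun z => complex.Im z) ImD (erefl : complex.Im (0 : R[i]) = 0)).
by congr (_ * _); apply: eq_bigr => i _; rewrite koopmanE toL2E.
Qed.

Let normE (g : X -> R[i]) (p q : L2H mu) N :
  (forall x, complex.Re (g x) = p x) -> (forall x, complex.Im (g x) = q x) ->
  L2C_norm mu (ergodic_average T Tinv a f N \- g)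
  = (nrm (N%:R^-1 *: \sum_(n < N) orbit_pair n - (p, q)))%:E.
Proof.
move=> hp hq.
have -> : N%:R^-1 *: \sum_(n < N) orbit_pair n - (p, q) =
   (N%:R^-1 *: \sum_(n < N) koopman Tmp (a n.+1) re - p,
    N%:R^-1 *: \sum_(n < N) koopman Tmp (a n.+1) im - q)
   :> prodH (L2H mu) (L2H mu).
  have -> : \sum_(n < N) orbit_pair n = (\sum_(n < N) koopman Tmp (a n.+1) re,
      \sum_(n < N) koopman Tmp (a n.+1) im) :> prodH (L2H mu) (L2H mu).
    elim: N => [|N IH]; first by rewrite !big_ord0.
    by rewrite !big_ord_recr/= IH.
  by [].
apply: L2C_norm_pair => x.
- have ReB (u v : R[i]) : complex.Re (u - v) = complex.Re u - complex.Re v.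
    by case: u v => [? ?] [].
  by rewrite ReB average_Re hp.
- have ImB (u v : R[i]) : complex.Im (u - v) = complex.Im u - complex.Im v.
    by case: u v => [? ?] [].
  by rewrite ImB average_Im hq.
Qed.

Lemma L2C_limit_mean :
  (exists2 g, L2C mu g &
     L2C_norm mu (ergodic_average T Tinv a f N \- g) @[N --> \oo] --> 0%E) <->
  exists G, mean_to orbit_pair G.
Proof.
have E N (G : prodH (L2H mu) (L2H mu)) : (0 < N)%N ->
    nrm (\sum_(n < N) orbit_pair n - N%:R *: G)
    = nrm (N%:R^-1 *: \sum_(n < N) orbit_pair n - G) * N%:R.
  exact: nrm_average.
split=> [[g hg]|[[p q] hG]].
  move=> hlim; exists (toL2 hg.1, toL2 hg.2) => e e0.
  have gE : (fun N => L2C_norm mu (ergodic_average T Tinv a f N \- g))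
    = EFin \o (fun N => nrm (N%:R^-1 *: \sum_(n < N) orbit_pair n
        - (toL2 hg.1, toL2 hg.2))).
    by apply/funext => N; apply: normE => x; rewrite toL2E.
  rewrite gE in hlim; move/fine_cvgP : hlim => [_ hlim].
  move/cvgr0Pnorm_le : hlim => /(_ _ e0) hN; near=> N.
  have N0 : (0 < N)%N by near: N; exact: nbhs_infty_gt.
  rewrite E// ler_wpM2r// -[leLHS]ger0_norm ?nrm_ge0//; near: N; exact: hN.
exists (fun x => (p x +i* q x)%C).
  by split; [exact: (L2_in p)|exact: (L2_in q)].
have -> : (fun N => L2C_norm mu (ergodic_average T Tinv a f N
     \- (fun x => (p x +i* q x)%C)))
  = EFin \o (fun N => nrm (N%:R^-1 *: \sum_(n < N) orbit_pair n - (p, q))).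
  by apply/funext => N; rewrite (@normE _ p q).
apply: cvg_EFin; first by apply: nearW.
apply/cvgr0Pnorm_le => e e0; near=> N.
have N0 : (0 < N)%N by near: N; exact: nbhs_infty_gt.
rewrite ger0_norm ?nrm_ge0// -(ler_pM2r (_ : 0 < N%:R)) ?ltr0n// -E//.
by near: N; exact: hG.
Unshelve. all: by end_near. Qed.

End ComplexFunctions.

(** * Rotations of the circle *)

Section Circle.
Context (R : realType).
Local Notation leb := (@lebesgue_measure R).
Local Notation RT := (measurableTypeR R).

Lemma measurable_shift (r : R) : measurable_fun setT (fun x : RT => x + r : RT).
Proof. exact: measurable_funD. Qed.

Lemma lebesgue_shift (r : R) (A : set RT) : measurable A ->
  leb ((fun x => x + r) @^-1` A) = leb A.
Proof.
move=> mA.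
apply/esym.
apply: (@lebesgue_measure_unique R (pushforward leb (fun x : RT => x + r : RT))) => //.
  exact: measurable_shift.
move=> mf _ [[a b] _ <-]; rewrite /= /pushforward.
have -> : (fun x => x + r) @^-1` `]a, b]%classic = `]a - r, b - r]%classic.
  by apply/seteqP; split=> x /=; rewrite !in_itv/= => /andP[h1 h2];
    apply/andP; split; lra.
rewrite !lebesgue_measure_itv/= !lte_fin ltrD2r.
by case: ifP => // _; rewrite -!EFinD; congr _%:E; lra.
Qed.

Definition unit_itv : set RT := `[0, 1[%classic.

Lemma measurable_unit_itv : measurable unit_itv.
Proof. exact: measurable_itv. Qed.

Definition circle_measure := mrestr leb measurable_unit_itv.

HB.instance Definition _ := Measure.on circle_measure.

Let circle_setT : circle_measure setT = 1%E.
Proof.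
rewrite /circle_measure /mrestr setTI lebesgue_measure_itv/= lte_fin ltr01.
by rewrite oppr0 addr0.
Qed.

HB.instance Definition _ :=
  @Measure_isProbability.Build _ _ R circle_measure circle_setT.

(** The rotation of [R / Z], realized on the fundamental domain; the points
    outside of it form a null set and are left fixed. *)
Definition rotate (t x : R) : R :=
  if (0 <= x) && (x < 1) then (if x < 1 - t then x + t else x + (t - 1)) else x.

Lemma rotate_low t x : 0 <= x -> x < 1 - t -> 0 < t -> rotate t x = x + t.
Proof.
move=> x0 xt t0; have x1 : x < 1 by lra.
by rewrite /rotate x0 x1 xt.
Qed.

Lemma rotate_high t x : 1 - t <= x -> x < 1 -> t < 1 -> rotate t x = x + (t - 1).
Proof.
move=> xt x1 t1; have x0 : 0 <= x by lra.
by rewrite /rotate x0 x1 ltNge xt.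
Qed.

Lemma rotate_out t x : ~~ ((0 <= x) && (x < 1)) -> rotate t x = x.
Proof. by rewrite /rotate => /negbTE->. Qed.

Lemma rotateK t : 0 < t < 1 -> cancel (rotate t) (rotate (1 - t)).
Proof.
move=> /andP[t0 t1] x.
have [/andP[x0 x1]|xo] := boolP ((0 <= x) && (x < 1)); last by rewrite !rotate_out.
have [xt|xt] := ltP x (1 - t).
  have h1 : 1 - (1 - t) <= x + t by lra.
  have h2 : x + t < 1 by lra.
  have h3 : 1 - t < 1 by lra.
  by rewrite (rotate_low x0 xt t0) (rotate_high h1 h2 h3); lra.
have h1 : 0 <= x + (t - 1) by lra.
have h2 : x + (t - 1) < 1 - (1 - t) by lra.
have h3 : 0 < 1 - t by lra.
by rewrite (rotate_high xt x1 t1) (rotate_low h1 h2 h3); lra.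
Qed.

Lemma rotate_preimage t (A : set R) : 0 < t < 1 ->
  rotate t @^-1` A = (A `&` ~` unit_itv) `|`
    (((fun x => x + t) @^-1` (A `&` `[t, 1[%classic)) `|`
     ((fun x => x + (t - 1)) @^-1` (A `&` `[0, t[%classic))).
Proof.
move=> /andP[t0 t1]; apply/seteqP; split=> x /=; rewrite /unit_itv /= !in_itv /=.
  have [/andP[x0 x1]|xo] := boolP ((0 <= x) && (x < 1)); last first.
    by rewrite rotate_out//; left; split=> //; exact/negP.
  have [xt|xt] := ltP x (1 - t).
    rewrite rotate_low// => Ax; right; left; split=> //.
    by apply/andP; split; lra.
  rewrite rotate_high// => Ax; right; right; split=> //.
  by apply/andP; split; lra.
case=> [[Ax /negP xo]|[[Ax /andP[h1 h2]]|[Ax /andP[h1 h2]]]].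
- by rewrite rotate_out.
- by rewrite rotate_low//; lra.
- by rewrite rotate_high//; lra.
Qed.

Lemma measurable_rotate t : 0 < t < 1 ->
  measurable_fun setT (rotate t : RT -> RT).
Proof.
move=> t01 _ A mA; rewrite setTI rotate_preimage//.
have ms r (C : set RT) : measurable C -> measurable ((fun x => x + r) @^-1` C).
  by move=> mC; rewrite -[_ @^-1` _]setTI; exact: measurable_shift.
apply: measurableU.
  by apply: measurableI => //; apply: measurableC; exact: measurable_unit_itv.
by apply: measurableU; apply: ms; apply: measurableI => //; exact: measurable_itv.
Qed.

Lemma circle_rotate t (A : set RT) : 0 < t < 1 -> measurable A ->
  circle_measure (rotate t @^-1` A) = circle_measure A.
Proof.
move=> t01 mA; have /andP[t0 t1] := t01.
have ms r (C : set RT) : measurable C -> measurable ((fun x => x + r) @^-1` C).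
  by move=> mC; rewrite -[_ @^-1` _]setTI; exact: measurable_shift.
have m1 : measurable (A `&` `[t, 1[%classic).
  by apply: measurableI => //; exact: measurable_itv.
have m2 : measurable (A `&` `[0, t[%classic).
  by apply: measurableI => //; exact: measurable_itv.
rewrite /circle_measure /mrestr.
have -> : rotate t @^-1` A `&` unit_itv =
    ((fun x => x + t) @^-1` (A `&` `[t, 1[%classic)) `|`
     ((fun x => x + (t - 1)) @^-1` (A `&` `[0, t[%classic)).
  rewrite rotate_preimage//; apply/seteqP; split=> x /=.
    by move=> [[[_ nx]|//] x1].
  rewrite /unit_itv /= !in_itv/= => h; split; first by right.
  by case: h => -[_ /andP[h1 h2]]; apply/andP; split; lra.
have -> : A `&` unit_itv = (A `&` `[t, 1[%classic) `|` (A `&` `[0, t[%classic).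
  apply/seteqP; split=> x /=; rewrite /unit_itv /= !in_itv/=.
    move=> [Ax /andP[x0 x1]]; case: (leP t x) => xt; [left|right].
      by rewrite x1.
    by rewrite x0.
  by case=> -[Ax /andP[h1 h2]]; split=> //; apply/andP; split; lra.
rewrite !measureU//; try exact: ms.
- by congr (_ + _)%E; exact: lebesgue_shift.
- apply/seteqP; split=> x //= [[_ +] [_ +]].
  rewrite !in_itv/= => /andP[h1 _] /andP[_ h2].
  by lra.
- apply/seteqP; split=> x //= [[_ +] [_ +]].
  rewrite !in_itv/= => /andP[h1 h3] /andP[h4 h2].
  by lra.
Qed.

Lemma rotate_measure_preserving t : 0 < t < 1 ->
  invertible_measure_preserving circle_measure (rotate t) (rotate (1 - t)).
Proof.
move=> t01; have t01' : 0 < 1 - t < 1 by move/andP: t01 => [? ?]; apply/andP; split; lra.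
split; first exact: rotateK.
- by have := rotateK t01'; rewrite (_ : 1 - (1 - t) = t); [|lra].
- exact: measurable_rotate.
- exact: measurable_rotate.
- by move=> A mA; exact: circle_rotate.
Qed.

Let wave_re (x : R) : R := cos (2 * pi * x) * \1_unit_itv x.
Let wave_im (x : R) : R := sin (2 * pi * x) * \1_unit_itv x.

Lemma wave_rotate t x : 0 < t < 1 ->
  wave_re (rotate t x) = cos (2 * pi * t) * wave_re x - sin (2 * pi * t) * wave_im x /\
  wave_im (rotate t x) = sin (2 * pi * t) * wave_re x + cos (2 * pi * t) * wave_im x.
Proof.
move=> /andP[t0 t1]; rewrite /wave_re /wave_im.
have inE (y : R) : (y \in unit_itv) = (0 <= y) && (y < 1).
  by apply/idP/idP; rewrite ?inE /unit_itv /= in_itv.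
have [/andP[x0 x1]|xo] := boolP ((0 <= x) && (x < 1)); last first.
  by rewrite rotate_out// !indicE inE (negbTE xo) !mulr0 subr0 addr0.
rewrite !indicE !inE x0 x1.
have [xt|xt] := ltP x (1 - t).
  have y0 : 0 <= x + t by lra.
  have y1 : x + t < 1 by lra.
  rewrite (rotate_low x0 xt t0) y0 y1 /=.
  by rewrite mulrDr cosD sinD; split; ring.
have y0 : 0 <= x + (t - 1) by lra.
have y1 : x + (t - 1) < 1 by lra.
rewrite (rotate_high xt x1 t1) y0 y1 /=.
have -> : 2 * pi * (x + (t - 1)) = 2 * pi * x + 2 * pi * t - pi *+ 2 :> R by ring.
rewrite -(cosD2pi (_ - _)) -(sinD2pi (_ - _)) subrK cosD sinD; split; ring.
Qed.

Lemma wave_iter t m x : 0 < t < 1 ->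
  wave_re (iter m (rotate t) x)
    = cos ((2 * pi * t) *+ m) * wave_re x - sin ((2 * pi * t) *+ m) * wave_im x /\
  wave_im (iter m (rotate t) x)
    = sin ((2 * pi * t) *+ m) * wave_re x + cos ((2 * pi * t) *+ m) * wave_im x.
Proof.
move=> t01; elim: m => [|m [IH1 IH2]].
  by rewrite mulr0n cos0 sin0 !mul1r !mul0r subr0 add0r.
rewrite iterS; have [-> ->] := wave_rotate (iter m (rotate t) x) t01.
by rewrite IH1 IH2 (mulrS (2 * pi * t)) cosD sinD; split; ring.
Qed.

Lemma wave_sqr x : wave_re x * wave_re x + wave_im x * wave_im x = \1_unit_itv x.
Proof.
rewrite /wave_re /wave_im; have := cos2Dsin2 (2 * pi * x).
set c := cos _; set s := sin _ => cs; rewrite indicE; case: (_ \in _) => /=.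
  by rewrite !mulr1 -!expr2.
by rewrite !mulr0 addr0.
Qed.

Let bounded_in_L2 (f : R -> R) : measurable_fun setT (f : RT -> R) ->
  (forall x, `|f x| <= 1) -> (f : RT -> R) \in Lfun circle_measure 2%:E.
Proof.
move=> mf f1; apply: in_L2 => //.
apply: (@le_lt_trans _ _ (\int[circle_measure]_x (cst 1%E) x)%E).
  apply: ge0_le_integral => //.
  - by move=> x _; rewrite lee_fin sqr_ge0.
  - by apply/measurable_EFinP; exact: measurable_funX.
  - by move=> x _; rewrite lee_fin -real_normK ?num_real// expr_le1.
rewrite integral_cst// mul1e.
suff : (circle_measure setT < +oo)%E by [].
by rewrite circle_setT ltry.
Qed.

Let indic_le1 x : `|\1_unit_itv x| <= 1 :> R.
Proof. by rewrite indicE; case: (_ \in _); rewrite ?normr1 ?normr0. Qed.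

Let wave_L2 : L2C circle_measure (fun x : RT => (wave_re x +i* wave_im x)%C).
Proof.
have mi : measurable_fun setT (\1_unit_itv : RT -> R).
  by apply: measurable_indic; exact: measurable_unit_itv.
have ml : measurable_fun setT (fun x : RT => 2 * pi * x : R).
  exact: measurable_funM.
split; apply: bounded_in_L2.
- apply: measurable_funM => //; apply: (measurableT_comp _ ml).
  by apply: continuous_measurable_fun; exact: continuous_cos.
- by move=> x; rewrite normrM mulr_ile1// ler_norml cos_geN1 cos_le1.
- apply: measurable_funM => //; apply: (measurableT_comp _ ml).
  by apply: continuous_measurable_fun; exact: continuous_sin.
- by move=> x; rewrite normrM mulr_ile1// ler_norml sin_geN1 sin_le1.
Qed.

(** The wave [exp (2 * pi * i * x)] is an eigenfunction of the rotation, so its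
    ergodic averages are multiples of it, and their inner products with the wave
    itself are the averages of the real parts of the eigenvalues. *)
Lemma good_hasmean_cos (a : nat -> nat) t : 0 < t < 1 ->
  good_for_mean_ergodic R (fun n => Posz (a n)) ->
  hasmean (V := realH R) (fun n => cos ((2 * pi * t) *+ a n.+1)).
Proof.
move=> t01 good; have Tmp := rotate_measure_preserving t01.
have := good _ _ _ _ _ Tmp _ wave_L2 => /(L2C_limit_mean Tmp wave_L2)[G].
pose F : prodH (L2H circle_measure) (L2H circle_measure) :=
  (toL2 wave_L2.1, toL2 wave_L2.2).
move=> /(mean_to_dot F) h.
apply: mean_to_hasmean (mean_to_ext _ h) => n.
change (L2_dot (koopman Tmp (Posz (a n.+1)) (toL2 wave_L2.1)) (toL2 wave_L2.1)
  + L2_dot (koopman Tmp (Posz (a n.+1)) (toL2 wave_L2.2)) (toL2 wave_L2.2)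
  = cos ((2 * pi * t) *+ a n.+1)).
rewrite /L2_dot -RintegralD//; try exact: L2_integrableM.
transitivity (\int[circle_measure]_x
    (cos ((2 * pi * t) *+ a n.+1) * \1_unit_itv x)).
  apply: eq_Rintegral => x _; rewrite !koopmanE !toL2E /=.
  have [-> ->] := wave_iter (a n.+1) x t01.
  by rewrite -wave_sqr; ring.
rewrite RintegralZl//; last first.
  by apply: integrable_indic => //; exact: measurable_unit_itv.
have -> : \int[circle_measure]_x \1_unit_itv x = 1.
  rewrite /Rintegral integral_indic//; last exact: measurable_unit_itv.
  rewrite setIT; suff : fine (circle_measure unit_itv) = 1 by [].
  have -> : circle_measure unit_itv = circle_measure setT.
    by rewrite /circle_measure /mrestr setTI setIid.
  by rewrite circle_setT.
by rewrite mulr1.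
Qed.

End Circle.

Theorem theoremA (R : realType) (B : set nat)
    (B_pos : forall b : nat, B b -> (0 < b)%N) :
  exists s : nat -> nat,
    [/\ forall n : nat, (1 <= n)%N -> (0 < s n)%N,
        forall m n : nat, (1 <= m)%N -> (m < n)%N -> (s m < s n)%N,
        forall g : nat, (1 <= g)%N -> ~ B g ->
          good_for_mean_ergodic R (fun n : nat => Posz (s n ^ g)%N) &
        forall b : nat, B b ->
          ~ good_for_mean_ergodic R (fun n : nat => Posz (s n ^ b)%N)].
Proof.
exists (bad_seq R B); split.
- exact: bad_seq_gt0.
- by move=> m n _; exact: bad_seq_increasing.
- move=> g g1 Bg d X mu T Tinv Tmp f hf; apply/(L2C_limit_mean Tmp hf).
  have h (u : L2H mu) := hasmean_complete (@L2_complete _ _ _ mu)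
    (hasmean_bad_seq B_pos (@L2_complete _ _ _ mu) (koopman Tmp) g1 u Bg).
  have [y hy] := h (toL2 hf.1); have [y' hy'] := h (toL2 hf.2).
  by exists (y, y'); exact: mean_to_pair.
- move=> b Bb good; have b0 := B_pos b Bb.
  have a0 : 0 < angle R by apply: acos_gt0; lra.
  have api : angle R < pi by apply: acos_ltpi; lra.
  have pi0 := pi_gt0 R.
  have p2 : 0 < 2 * pi :> R by rewrite mulr_gt0.
  have cosmean (t : R) : 0 < t < 2 * pi ->
      hasmean (V := realH R) (fun n => cos (t *+ (bad_seq R B n.+1 ^ b))).
    move=> /andP[t0 t1]; have h : 0 < t / (2 * pi) < 1.
      by rewrite divr_gt0//= ltr_pdivrMr// mul1r.
    have := good_hasmean_cos (a := fun n => (bad_seq R B n ^ b)%N) h good.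
    by rewrite mulrC divfK// gt_eqF.
  by apply: (bad_seq_not_hasmean B_pos b0 Bb); apply: cosmean; apply/andP; split; lra.
Qed.
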